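(* Let $N\ge1$, $m\in\{1,\dots,N\}$, $0<\gamma<N$ and $\alpha>0$. Let $u_0\in\mathcal X_{m,\gamma}$, $u_0\ge0$. Then the solution $u(t)=\mathcal S_m(t)u_0$ of $u_t-\Delta u+|u|^\alpha u=0$ with initial data $u(0)=u_0$ satisfies $$u(t,x)\le\frac{e^{t\Delta_m}u_0(x)}{\left(1+\alpha t\left(e^{t\Delta_m}u_0(x)\right)^\alpha\right)^{1/\alpha}}$$ for all $t>0$ and all $x\in\Omega_m$.
   Context: $\Omega_m=\{x\in\mathbb R^N: x_1>0,\dots,x_m>0\}$. Let $\rho_m(x)=\dfrac{|x|^{\gamma+2m}}{x_1\cdots x_m}$ for $x\in\Omega_m$. $\mathcal X_{m,\gamma}$ is the Banach space of (a.e. classes of) measurable $\psi:\Omega_m\to\mathbb R$ with $\rho_m\psi\in L^\infty(\Omega_m)$, normed by $\|\psi\|_{\mathcal X_{m,\gamma}}=\|\rho_m\psi\|_{L^\infty(\Omega_m)}$. $C_0(\Omega_m)$ is the space of continuous $f:\overline{\Omega_m}\to\mathbb R$ with $f=0$ on $\partial\Omega_m$ and $f(x)\to0$ as $|x|\to\infty$ in $\Omega_m$, with the sup norm. The heat semigroup on $\Omega_m$ is $e^{t\Delta_m}\psi(x)=\int_{\Omega_m}K_t(x,y)\psi(y)\,dy$, $t>0$, with $$K_t(x,y)=(4\pi t)^{-N/2}\prod_{j=m+1}^N e^{-\frac{|x_j-y_j|^2}{4t}}\prod_{i=1}^m\Big[e^{-\frac{|x_i-y_i|^2}{4t}}-e^{-\frac{|x_i+y_i|^2}{4t}}\Big].$$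 For $u_0\in\mathcal X_{m,\gamma}$, $\mathcal S_m(t)u_0=u(t)$, $t>0$, where $u\in C((0,\infty),C_0(\Omega_m))$ is the unique (classical on $(0,\infty)\times\Omega_m$) solution of $u_t-\Delta u+|u|^\alpha u=0$ such that $u(t)\to u_0$ in $L^1_{\rm loc}(\Omega_m)$ as $t\to0$ and $\|u(t)\|_{\mathcal X_{m,\gamma}}\le C\|u_0\|_{\mathcal X_{m,\gamma}}$ for all $t>0$ with $C$ independent of $u_0$ (existence and uniqueness of such $u$ being known). *)

(* Defs.v *)
From HB Require Import structures.
From mathcomp Require Import all_boot all_order all_algebra.
From mathcomp Require Import all_classical all_reals all_analysis.

Set Implicit Arguments.
Unset Strict Implicit.
Unset Printing Implicit Defensive.

Import Order.TTheory GRing.Theory Num.Theory.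
Import numFieldNormedType.Exports.

Local Open Scope classical_set_scope.
Local Open Scope ring_scope.

(* R^n is 'rV[R]_n, with the topology, norm and derivatives of the library.
   The library has no sigma-algebra on matrices: as for n.-tuple, we take the
   one generated by the coordinates, i.e. the Borel sigma-algebra of R^n. *)
Section rV_measurable.
Context {R : realType}.
Variable n : nat.

Let coord (i : 'I_n) (x : 'rV[R]_n) : R := x ord0 i.

Let rV_set0 : g_sigma_preimage coord set0.
Proof. exact: sigma_algebra0. Qed.

Let rV_setC A : g_sigma_preimage coord A -> g_sigma_preimage coord (~` A).
Proof. exact: sigma_algebraC. Qed.

Let rV_bigcup (F : _^nat) : (forall i, g_sigma_preimage coord (F i)) ->
  g_sigma_preimage coord (\bigcup_i (F i)).
Proof. exact: sigma_algebra_bigcup. Qed.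

HB.instance Definition _ := @isMeasurable.Build default_measure_display
  'rV[R]_n (g_sigma_preimage coord) rV_set0 rV_setC rV_bigcup.

End rV_measurable.

Lemma measurable_coord {R : realType} n (i : 'I_n) :
  measurable_fun [set: 'rV[R]_n] (fun x : 'rV[R]_n => x ord0 i : R).
Proof.
move=> _ Y mY; rewrite setTI; apply: sub_sigma_algebra => /=.
rewrite -bigcup_seq/=; exists i => /=; first by rewrite mem_index_enum.
by exists Y => //; rewrite setTI.
Qed.

Lemma measurable_fun_rV {R : realType} d (T : measurableType d) n
    (f : T -> 'rV[R]_n) :
  (forall i, measurable_fun [set: T] (fun t => f t ord0 i : R)) ->
  measurable_fun [set: T] f.
Proof.
move=> mf; suff H : g_sigma_preimage (fun i t => f t ord0 i : R) `<=` measurable.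
  move=> _ A mA; rewrite setTI; apply: H.
  rewrite (g_sigma_preimage_comp (fun (i : 'I_n) (x : 'rV[R]_n) => x ord0 i : R)).
  by exists A => //; rewrite setTI.
apply: smallest_sub; first exact: sigma_algebra_measurable.
rewrite -bigcup_seq/=; apply: bigcup_sub => i _.
by move=> A [B mB <-]; exact: mf.
Qed.

Section cons_rV.
Context {R : realType}.
Variable n : nat.

Definition cons_rV (p : R * 'rV[R]_n) : 'rV[R]_n.+1 :=
  \row_i (if unlift ord0 i is Some j then p.2 ord0 j else p.1).

Definition uncons_rV (x : 'rV[R]_n.+1) : R * 'rV[R]_n :=
  (x ord0 ord0, \row_j x ord0 (lift ord0 j)).

Lemma cons_rV0 p : cons_rV p ord0 ord0 = p.1.
Proof. by rewrite mxE unlift_none. Qed.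

Lemma cons_rVS p j : cons_rV p ord0 (lift ord0 j) = p.2 ord0 j.
Proof. by rewrite mxE liftK. Qed.

Lemma cons_rVK : cancel cons_rV uncons_rV.
Proof.
move=> [a x]; rewrite /uncons_rV cons_rV0; congr pair.
by apply/rowP => j; rewrite mxE cons_rVS.
Qed.

Lemma uncons_rVK : cancel uncons_rV cons_rV.
Proof.
move=> x; apply/rowP => i; case: (unliftP ord0 i) => [j|] ->.
  by rewrite cons_rVS mxE.
by rewrite cons_rV0.
Qed.

Lemma measurable_cons_rV : measurable_fun [set: R * 'rV[R]_n] cons_rV.
Proof.
apply: measurable_fun_rV => i; case: (unliftP ord0 i) => [j|] ->.
  rewrite (_ : (fun _ => _) = (fun x : 'rV[R]_n => x ord0 j : R) \o snd).
    exact: measurableT_comp (measurable_coord j) measurable_snd.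
  by apply/funext => p; rewrite /= cons_rVS.
rewrite (_ : (fun _ => _) = fst); first exact: measurable_fst.
by apply/funext => p; rewrite cons_rV0.
Qed.

Lemma measurable_uncons_rV : measurable_fun [set: 'rV[R]_n.+1] uncons_rV.
Proof.
apply/measurable_fun_pairP; split; first exact: measurable_coord.
apply: measurable_fun_rV => j.
rewrite (_ : (fun _ => _) = (fun x : 'rV[R]_n.+1 => x ord0 (lift ord0 j) : R)).
  exact: measurable_coord.
by apply/funext => p; rewrite /= mxE.
Qed.

Variable mu : {sigma_finite_measure set 'rV[R]_n -> \bar R}.

Definition cons_measure : set 'rV[R]_n.+1 -> \bar R :=
  pushforward (@lebesgue_measure R \x mu)%E cons_rV.

Let cons_measure0 : cons_measure set0 = 0%E.
Proof. by rewrite /cons_measure /pushforward preimage_set0 measure0. Qed.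

Let cons_measure_ge0 A : (0 <= cons_measure A)%E.
Proof. by rewrite /cons_measure /pushforward measure_ge0. Qed.

Let cons_measure_sigma_additive : semi_sigma_additive cons_measure.
Proof.
have mcons A : measurable A -> measurable (cons_rV @^-1` A).
  by move=> mA; rewrite -[X in measurable X]setTI; exact: measurable_cons_rV.
move=> F mF tF mUF; rewrite /cons_measure /pushforward preimage_bigcup.
apply: measure_semi_sigma_additive => [k| |].
- exact: mcons.
- apply/trivIsetP => /= i j _ _ ij; rewrite -preimage_setI.
  by move/trivIsetP : tF => /(_ _ _ _ _ ij) ->//; rewrite preimage_set0.
- by rewrite -preimage_bigcup; exact: mcons.
Qed.

HB.instance Definition _ := isMeasure.Build _ _ _ cons_measure
  cons_measure0 cons_measure_ge0 cons_measure_sigma_additive.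

Let cons_measure_sigma_finite : sigma_finite [set: 'rV[R]_n.+1] cons_measure.
Proof.
have /sigma_finiteP[F [TF ndF Foo]] := sigma_finiteT (@lebesgue_measure R).
have /sigma_finiteP[G [TG ndG Goo]] := sigma_finiteT mu.
exists (fun k => uncons_rV @^-1` (F k `*` G k)).
  apply/esym/seteqP; split=> // x _.
  have [i _ Fi] : (\bigcup_i F i) (uncons_rV x).1 by rewrite -TF.
  have [j _ Gj] : (\bigcup_i G i) (uncons_rV x).2 by rewrite -TG.
  exists (maxn i j) => //; split.
  - by move: Fi; exact/subsetPset/ndF/leq_maxl.
  - by move: Gj; exact/subsetPset/ndG/leq_maxr.
move=> k; have [mF muF] := Foo k; have [mG muG] := Goo k; split.
  rewrite -[X in measurable X]setTI; apply: measurable_uncons_rV => //.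
  exact: measurableX.
rewrite /cons_measure /pushforward -comp_preimage.
rewrite (_ : _ \o _ = id); last exact/funext/cons_rVK.
by rewrite preimage_id product_measure1E// lte_mul_pinfty// ge0_fin_numE.
Qed.

HB.instance Definition _ := Measure_isSigmaFinite.Build _ _ _ cons_measure
  cons_measure_sigma_finite.

End cons_rV.

Fixpoint lebesgue_rV (R : realType) (n : nat) :
    {sigma_finite_measure set 'rV[R]_n -> \bar R} :=
  match n with
  | 0 => dirac (0 : 'rV[R]_0)
  | n'.+1 => cons_measure (lebesgue_rV R n')
  end.

Lemma lebesgue_rV_box (R : realType) n (A : 'I_n -> set R) :
  (forall i, measurable (A i)) ->
  lebesgue_rV R n [set x | forall i, A i (x ord0 i)] =
  (\prod_(i < n) lebesgue_measure (A i))%E.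
Proof.
elim: n A => [|n IHn] A mA.
  rewrite big_ord0 /= diracE mem_set//= => -[].
  by [].
rewrite big_ord_recl -IHn//.
set B := (X in lebesgue_rV R n X).
have mB : measurable B.
  have -> : B = \bigcap_(i in [set: 'I_n])
      [set x : 'rV[R]_n | A (lift ord0 i) (x ord0 i)].
    by apply/seteqP; split => x /= h i; [move=> _|]; exact: h.
  apply: fin_bigcap_measurable => // i _.
  rewrite -[X in measurable X]setTI.
  exact: (measurable_coord i measurableT (mA (lift ord0 i))).
rewrite -product_measure1E//; last exact: mA.
rewrite /= /cons_measure /pushforward; congr (_ _).
apply/seteqP; split => [p /= h|p /= [h0 hS] i].
  by split => [|j]; [rewrite -(cons_rV0 p)|rewrite -cons_rVS]; exact: h.
by case: (unliftP ord0 i) => [j|] ->; rewrite ?cons_rVS ?cons_rV0.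
Qed.

Section heat_equation.
Context {R : realType} {N : nat}.
Implicit Types (m : nat) (gamma alpha t C : R) (x y : 'rV[R]_N).
Implicit Types (psi : 'rV[R]_N -> R) (u : R -> 'rV[R]_N -> R).

(* The coordinates are numbered from 0: x_1, ..., x_m in the usual notation are
   the x ord0 i with (i < m)%N. *)
Definition Omega m : set 'rV[R]_N :=
  [set x | forall i : 'I_N, (i < m)%N -> 0 < x ord0 i].

(* The norm `|x| of the library on matrices is the sup norm. *)
Definition enorm x : R := Num.sqrt (\sum_(i < N) x ord0 i ^+ 2).

Definition rho m gamma x : R :=
  enorm x `^ (gamma + 2 * m%:R) / \prod_(i < N | (i < m)%N) x ord0 i.

(* The L^oo norm on Omega m is the L^oo norm of the extension by 0. *)
Definition Xnorm m gamma psi : \bar R :=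
  'N[lebesgue_rV R N]_+oo[
    (fun x => (rho m gamma x * psi x)%:E) \_ (Omega m) ]%E.

Definition Xspace m gamma psi : Prop :=
  measurable_fun (Omega m) psi /\ (Xnorm m gamma psi < +oo)%E.

Record C0space m psi : Prop := {
  C0_continuous : {within closure (Omega m), continuous psi} ;
  C0_boundary : forall x, (closure (Omega m) `\` Omega m) x -> psi x = 0 ;
  C0_infty : forall e : R, 0 < e -> exists M : R,
    forall x, Omega m x -> M < enorm x -> `|psi x| < e }.

Definition heat_kernel m t x y : R :=
  (4 * pi * t) `^ (- (N%:R / 2)) *
  (\prod_(j < N | (m <= j)%N)
     expR (- (`|x ord0 j - y ord0 j| ^+ 2 / (4 * t)))) *
  \prod_(i < N | (i < m)%N)
     (expR (- (`|x ord0 i - y ord0 i| ^+ 2 / (4 * t)))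
      - expR (- (`|x ord0 i + y ord0 i| ^+ 2 / (4 * t)))).

Definition heat_semigroup m t psi x : R :=
  \int[lebesgue_rV R N]_(y in Omega m) (heat_kernel m t x y * psi y).

Definition dt u t x : R := derive1 (u ^~ x) t.

Definition dx (i : 'I_N) u t x : R := 'D_(delta_mx ord0 i) (u t) x.

Definition laplacian u t x : R := \sum_(i < N) dx i (dx i u) t x.

Record is_C12 m u : Prop := {
  C12_derivable_t : forall t x, 0 < t -> Omega m x -> derivable (u ^~ x) t 1 ;
  C12_derivable_x : forall i t x, 0 < t -> Omega m x ->
    derivable (u t) x (delta_mx ord0 i) ;
  C12_derivable_xx : forall i j t x, 0 < t -> Omega m x ->
    derivable (dx i u t) x (delta_mx ord0 j) ;
  C12_continuous : forall t x, 0 < t -> Omega m x ->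
    {for (t, x), continuous (fun p : R * 'rV[R]_N => u p.1 p.2)} ;
  C12_continuous_t : forall t x, 0 < t -> Omega m x ->
    {for (t, x), continuous (fun p : R * 'rV[R]_N => dt u p.1 p.2)} ;
  C12_continuous_x : forall i t x, 0 < t -> Omega m x ->
    {for (t, x), continuous (fun p : R * 'rV[R]_N => dx i u p.1 p.2)} ;
  C12_continuous_xx : forall i j t x, 0 < t -> Omega m x ->
    {for (t, x), continuous (fun p : R * 'rV[R]_N => dx j (dx i u) p.1 p.2)} }.

(* u is the function t |-> S_m(t) u0. The constant C in the bound of u(t) by u0
   is a parameter of the predicate: it does not depend on u0. *)
Record is_solution m gamma alpha C (u0 : 'rV[R]_N -> R) u : Prop := {
  sol_C0 : forall t, 0 < t -> C0space m (u t) ;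
  sol_continuous : forall t, 0 < t ->
    {uniform closure (Omega m), u @ t --> u t} ;
  sol_classical : is_C12 m u ;
  sol_equation : forall t x, 0 < t -> Omega m x ->
    dt u t x - laplacian u t x + `|u t x| `^ alpha * u t x = 0 ;
  sol_initial : forall K : set 'rV[R]_N, compact K -> K `<=` Omega m ->
    (\int[lebesgue_rV R N]_(x in K) `|u t x - u0 x|%:E)%E @[t --> 0^'+]
      --> 0%E ;
  sol_bound : forall t, 0 < t ->
    (Xnorm m gamma (u t) <= C%:E * Xnorm m gamma u0)%E }.

End heat_equation.

(* Main.v *)
Require Import Defs.
From mathcomp Require Import all_boot all_order all_algebra.
From mathcomp Require Import all_classical all_reals all_analysis.
From mathcomp Require Import measurable_realfun normal_distribution ess_sup_inf.
From mathcomp Require Import ring lra.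

(** Let h(s, v) = v / (1 + alpha s v^alpha)^(1/alpha): this is the value at time
s of the solution of v' = - v^(1 + alpha) which starts at v.  The theorem says
that u(t) <= h(t, e^(t Delta) u0): diffusion first and absorption afterwards give
more than both together.  The reason is that h is concave in v: if V > 0 solves the heat equation then
w(t, x) = h(t, V(t, x)) satisfies
  w_t - Delta w + w^(1 + alpha) = - h_vv |grad V|^2 >= 0,
so w is a supersolution of the equation of u, and the maximum principle
propagates u <= w from an initial time to all later times ([comparison]).  The
computation with h_vv is replaced by the inequality behind it: h(t, .) lies below
its tangents, so a maximum of u - w is also a maximum of u - b V, where b is the
slope of h at that point ([absorb_le_tangent]), and only the heat equation for
V is left to use.

The initial value u0 may be singular at the origin and is taken only in
L^1_loc, so the comparison starts at a time s > 0, where u(s) is continuous,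
vanishes on the boundary and decays.  Cutting u(s) down to phi = (u(s) - e)^+
makes it compactly supported inside Omega; its heat potential
V(t, x) = int K_t(x, y) phi(y) dy is then a classical solution of the heat
equation, obtained by differentiating under the integral, and V + 3 e dominates
u shortly after time s because K_t is an approximate identity
([approximate_identity]).  This gives u(s + t) <= h(t, v) for each v larger
than int K_t(x, y) u(s, y)^+ dy ([sol_le_absorb]).

It remains to let s go to 0 with t, hence with the kernel K_t(x, .), fixed.  The
bound of u(s) and u0 in the weighted space is uniform in s, and K_t(x, .) / rho
is integrable on Omega: near the origin K_t(x, y) is of the order of
y_1 ... y_m, which leaves |y|^(-gamma) with gamma < N
([hkernel_invrho_integrable]).  So the contribution to
int K_t(x, y) |u(s, y) - u0(y)| dy of the complement of a large compact subset of
Omega is small uniformly in s, while on that subset the kernel is bounded and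
the convergence in L^1_loc applies ([weighted_initial_trace]). *)

Set Implicit Arguments.
Unset Strict Implicit.
Unset Printing Implicit Defensive.

Import Order.TTheory GRing.Theory Num.Theory.
Import numFieldNormedType.Exports.

Local Open Scope classical_set_scope.
Local Open Scope ring_scope.

(** * Borel sets and integrals of products on R^n *)

Section rV_borel.
Context {R : realType}.

(** The sigma-algebra is generated by the coordinates, while continuity speaks of
the sup-norm topology: they meet because an open set is the union of the
countably many cubes with rational centre and radius 1/(k+1) that it contains. *)
Lemma open_measurable_rV n (A : set 'rV[R]_n) : open A -> measurable A.
Proof.
move=> oA.
pose box (p : 'rV[rat]_n * nat) : set 'rV[R]_n :=
  [set x | forall i, ball (ratr (p.1 ord0 i) : R) p.2.+1%:R^-1 (x ord0 i)].
have -> : A = \bigcup_p (if `[< box p `<=` A >] then box p else set0).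
  apply/seteqP; split=> [x Ax|x [p /= _]]; last by case: asboolP => // + px; exact.
  have /nbhs_ballP[e /= e0 eA] := open_nbhs_nbhs (conj oA Ax).
  have e20 : 0 < e / 2 by rewrite divr_gt0.
  have [k _ ke] : \forall k \near \oo, k.+1%:R^-1 < e / 2 :> R.
    exact: near_infty_natSinv_lt (PosNum e20).
  have {}ke := ke k (leqnn k).
  have d0 : 0 < k.+1%:R^-1 :> R by rewrite invr_gt0.
  have /choice[q qP] : forall i : 'I_n, exists q : rat,
      ball (ratr q : R) k.+1%:R^-1 (x ord0 i).
    move=> i; set d := k.+1%:R^-1 in d0 *.
    have : x ord0 i - d < x ord0 i + d by lra.
    move=> /rat_in_itvoo[q]; rewrite in_itv/= => /andP[q1 q2]; exists q.
    by rewrite /ball/= ltr_norml; apply/andP; split; lra.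
  exists (\row_i q i, k) => //=; case: asboolP => [_ i|]; first by rewrite mxE.
  case=> y /= yb; apply: eA; split => // i j; rewrite (ord1 i).
  have := qP j; have := yb j; rewrite mxE; move: ke d0.
  set d := _^-1; set r := ratr _ => ke d0; rewrite /ball/= !ltr_norml.
  by move=> /andP[? ?] /andP[? ?]; apply/andP; split; lra.
apply: countable_bigcupT_measurable => [|p]; first exact: countableP.
case: asboolP => // _; rewrite (_ : box p = \bigcap_(i in [set: 'I_n])
    [set x : 'rV[R]_n | ball (ratr (p.1 ord0 i) : R) p.2.+1%:R^-1 (x ord0 i)]).
  apply: fin_bigcap_measurable => // i _; rewrite -[X in measurable X]setTI.
  apply: (measurable_coord i measurableT).
  by apply: open_measurable; exact: ball_open.
by apply/seteqP; split => x /= h i; [move=> _|]; exact: h.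
Qed.

Lemma continuous_measurable_rV n (f : 'rV[R]_n -> R) :
  continuous f -> measurable_fun [set: 'rV[R]_n] f.
Proof.
move=> /continuousP cf; apply: (measurability _ (RGenOpens.measurableE R)).
by move=> _ -[_ [a [b ->]] <-]; rewrite setTI; apply: open_measurable_rV;
  apply: cf; exact: interval_open.
Qed.

(** Tonelli's theorem, applied to one coordinate at a time as in the recursive
definition of the measure. *)
Lemma integral_rV_prod n (f : 'I_n -> R -> R) :
  (forall i, measurable_fun [set: R] (f i)) -> (forall i z, 0 <= f i z) ->
  (\int[lebesgue_rV R n]_y (\prod_(i < n) f i (y ord0 i))%:E =
   \prod_(i < n) \int[lebesgue_measure]_z (f i z)%:E)%E.
Proof.
elim: n f => [|n IH] f mf f0.
  rewrite big_ord0 /=; under eq_integral do rewrite big_ord0.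
  by rewrite integral_cst//= diracT mule1.
have mprod k (g : 'I_k -> R -> R) : (forall i, measurable_fun [set: R] (g i)) ->
    measurable_fun [set: 'rV[R]_k] (fun y => \prod_(i < k) g i (y ord0 i)).
  move=> mg; apply: measurable_prod => i _.
  exact: measurableT_comp (mg i) (measurable_coord i).
rewrite /= /cons_measure ge0_integral_pushforward//=; last 3 first.
- exact: measurable_cons_rV.
- by apply/measurable_EFinP; exact: mprod.
- by move=> y _; rewrite lee_fin prodr_ge0.
rewrite preimage_setT.
transitivity (\int[lebesgue_measure \x lebesgue_rV R n]_p
    ((f ord0 p.1)%:E * (\prod_(i < n) f (lift ord0 i) (p.2 ord0 i))%:E))%E.
  apply: eq_integral => p _ /=; rewrite big_ord_recl cons_rV0 -EFinM.
  by congr (_ * _)%:E; apply: eq_bigr => i _; rewrite cons_rVS.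
rewrite fubini_tonelli1/=; last 2 first.
- apply: emeasurable_funM; apply/measurable_EFinP.
    exact: measurableT_comp (mf _) measurable_fst.
  exact: measurableT_comp (mprod n (fun i => f (lift ord0 i)) _) measurable_snd.
- by move=> p; rewrite -EFinM lee_fin mulr_ge0// prodr_ge0.
rewrite /fubini_F/= big_ord_recl -IH//.
have E (x : R) : (\int[lebesgue_rV R n]_y
    ((f ord0 x)%:E * (\prod_(i < n) f (lift ord0 i) (y ord0 i))%:E) =
    (f ord0 x)%:E *
    \int[lebesgue_rV R n]_y (\prod_(i < n) f (lift ord0 i) (y ord0 i))%:E)%E.
  rewrite ge0_integralZl//.
  - apply/measurable_EFinP.
    exact: (mprod n (fun i => f (lift ord0 i)) (fun i => mf _)).
  - by move=> y _; rewrite lee_fin prodr_ge0.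
  - by rewrite lee_fin.
under eq_integral do rewrite E.
rewrite ge0_integralZr//.
- by apply/measurable_EFinP; exact: mf.
- by move=> x _; rewrite lee_fin.
- by apply: integral_ge0 => y _; rewrite lee_fin prodr_ge0.
Qed.

End rV_borel.

(** * Derivatives of sums, products and compositions *)

Section pointwise_derivative_rules.
Context {R : realType}.
Implicit Types (f g : R -> R) (x : R).

Lemma is_derive_addf f g x df dg : is_derive x 1 f df -> is_derive x 1 g dg ->
  is_derive x 1 (fun y => f y + g y) (df + dg).
Proof. by move=> ? ?; exact: is_deriveD. Qed.

Lemma is_derive_oppf f x df : is_derive x 1 f df ->
  is_derive x 1 (fun y => - f y) (- df).
Proof. by move=> ?; exact: is_deriveN. Qed.

Lemma is_derive_mulf f g x df dg : is_derive x 1 f df -> is_derive x 1 g dg ->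
  is_derive x 1 (fun y => f y * g y) (df * g x + f x * dg).
Proof.
move=> ? ?; apply: (is_derive_eq (is_deriveM _ _)).
by rewrite addrC [g x *: df]mulrC.
Qed.

Lemma is_derive_compf f g x df dg : is_derive (g x) 1 f df ->
  is_derive x 1 g dg -> is_derive x 1 (fun y => f (g y)) (df * dg).
Proof. by move=> ? ?; exact: is_derive1_comp. Qed.

Lemma is_derive_invf f x df : f x != 0 -> is_derive x 1 f df ->
  is_derive x 1 (fun y => (f y)^-1) (- (df / f x ^+ 2)).
Proof.
move=> f0 ?; apply: (is_derive_eq (is_deriveV f0 _)).
by rewrite /GRing.scale/= mulNr mulrC.
Qed.

Lemma is_derive_prodf n (f : 'I_n -> R -> R) (df : 'I_n -> R) x :
  (forall i, is_derive x 1 (f i) (df i)) ->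
  is_derive x 1 (fun y => \prod_(i < n) f i y)
    (\sum_(i < n) df i * \prod_(j < n | j != i) f j x).
Proof.
elim: n f df => [|n IH] f df fdf.
  rewrite big_ord0 (_ : (fun _ => _) = cst 1) ?funeqE => [|y]; last by rewrite big_ord0.
  exact: is_derive_cst.
have := is_derive_mulf (fdf ord0) (IH _ _ (fun i => fdf (lift ord0 i))).
rewrite (_ : (fun y => _) = (fun y => \prod_(i < n.+1) f i y)); last first.
  by apply/funext => y; rewrite big_ord_recl.
move=> H; apply: (is_derive_eq H); rewrite big_ord_recl; congr (_ * _ + _).
  rewrite [RHS]big_mkcond big_ord_recl/= ?eqxx mul1r.
  by apply: eq_bigr => i _.
rewrite mulr_sumr; apply: eq_bigr => i _.
rewrite [in RHS]big_mkcond big_ord_recl/= mulrCA; congr (_ * (_ * _)).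
by rewrite big_mkcond/=; apply: eq_bigr => j _; rewrite (inj_eq lift_inj).
Qed.

End pointwise_derivative_rules.

(** * The heat kernel in one variable *)

Section gaussian.
Context {R : realType}.
Implicit Types (t x y z : R).

(** The factor (4 pi t)^(-1/2) is put inside the exponential, so that the time
derivative needs only those of [expR] and [ln]. *)
Definition gaussian t z : R := expR (- (ln (4 * pi * t) / 2) - z ^+ 2 / (4 * t)).

Lemma gaussian_gt0 t z : 0 < gaussian t z.
Proof. exact: expR_gt0. Qed.

Lemma gaussianE t z : 0 < t ->
  gaussian t z = (4 * pi * t) `^ (- 2^-1) * expR (- (z ^+ 2 / (4 * t))).
Proof.
move=> t0; have p0 := pi_gt0 R.
rewrite /gaussian expRD /powR; case: eqP => [h|_].
  by have : 0 < 4 * pi * t; [rewrite !mulr_gt0//|rewrite h ltxx].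
by congr (expR _ * _); rewrite mulNr mulrC.
Qed.

Lemma gaussianN t z : gaussian t (- z) = gaussian t z.
Proof. by rewrite /gaussian sqrrN. Qed.

Lemma gaussian_normal_pdf t z : 0 < t ->
  gaussian t z = normal_pdf 0 (Num.sqrt (2 * t)) z.
Proof.
move=> t0; have p0 := pi_gt0 R; have s0 : 0 < Num.sqrt (2 * t).
  by rewrite sqrtr_gt0 mulr_gt0.
rewrite gaussianE// normal_pdfE ?gt_eqF// /normal_peak /normal_fun subr0.
rewrite sqr_sqrtr ?mulr_ge0// ?(ltW t0)//; congr (_ * expR _).
  rewrite powRN powR12_sqrt ?mulr_ge0 ?(ltW t0) ?(ltW p0)//.
  by congr (Num.sqrt _)^-1; rewrite -mulr_natr; ring.
by rewrite mulNr -(mulr_natr (2 * t)); congr (- (_ / _)); ring.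
Qed.

(** The Hermite-type factors that the first two space derivatives put in front of
the Gaussian. *)
Definition gaussian_poly (k : nat) t z : R :=
  match k with
  | 0 => 1
  | 1 => - (z / (2 * t))
  | _ => z ^+ 2 / (4 * t ^+ 2) - 1 / (2 * t)
  end.

Definition dgaussian k t z : R := gaussian_poly k t z * gaussian t z.

Lemma is_derive_gaussian t z : 0 < t ->
  is_derive z 1 (gaussian t) (dgaussian 1 t z).
Proof.
move=> t0.
have h : is_derive z 1 (fun z => - (ln (4 * pi * t) / 2) - z ^+ 2 / (4 * t))
    (- (z / (2 * t))).
  have h1 : is_derive z 1 (fun z => z * z / (4 * t)) _ :=
    is_derive_mulf (is_derive_mulf (is_derive_id z 1) (is_derive_id z 1))
    (is_derive_cst (4 * t)^-1 z 1).
  apply: (is_derive_eq (is_derive_addf (is_derive_cst (- (ln (4 * pi * t) / 2)) z 1)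
    (is_derive_oppf h1))).
  by rewrite /=; field; lra.
apply: (is_derive_eq (is_derive_compf (is_derive_expR _) h)).
by rewrite /dgaussian /= mulrC.
Qed.

Lemma is_derive_dgaussian t z : 0 < t ->
  is_derive z 1 (dgaussian 1 t) (dgaussian 2 t z).
Proof.
move=> t0.
have h1 : is_derive z 1 (fun z => - (z / (2 * t))) _ :=
  is_derive_oppf (is_derive_mulf (is_derive_id z 1) (is_derive_cst (2 * t)^-1 z 1)).
apply: (is_derive_eq (is_derive_mulf h1 (is_derive_gaussian z t0))).
by rewrite /dgaussian /=; field; lra.
Qed.

(** The one-dimensional heat equation: the time derivative is the second space
derivative. *)
Lemma is_derive_gaussian_time t z : 0 < t ->
  is_derive t 1 (fun t => gaussian t z) (dgaussian 2 t z).
Proof.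
move=> t0; have p0 := pi_gt0 R.
have h0 : is_derive t 1 (fun t => 4 * pi * t) (4 * pi).
  apply: (is_derive_eq (is_derive_mulf (is_derive_cst (4 * pi) t 1) (is_derive_id t 1))).
  by rewrite /= mul0r add0r mulr1.
have q0 : 0 < 4 * pi * t by rewrite !mulr_gt0.
have h1 := is_derive_oppf (is_derive_mulf (is_derive_compf (is_derive1_ln q0) h0)
  (is_derive_cst (2^-1 : R) t 1)).
have h4 : is_derive t 1 (fun t => 4 * t) 4.
  apply: (is_derive_eq (is_derive_mulf (is_derive_cst (4 : R) t 1) (is_derive_id t 1))).
  by rewrite /= mul0r add0r mulr1.
have h2 := is_derive_oppf (is_derive_mulf (is_derive_cst (z ^+ 2) t 1)
  (is_derive_invf (lt0r_neq0 (mulr_gt0 (ltr0Sn _ 3) t0)) h4)).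
apply: (is_derive_eq (is_derive_compf (is_derive_expR _) (is_derive_addf h1 h2))).
rewrite /dgaussian -[X in X * _]/(gaussian t z) [LHS]mulrC; congr (_ * _); rewrite /= mulr0 mul0r addr0 add0r.
move: p0 t0 {h0 q0 h1 h4 h2}; generalize (pi : R) => q p0 t0.
by field; rewrite !gt_eqF.
Qed.

(** The kernel of the half-line with Dirichlet condition when [b] holds, by
reflection, and of the line otherwise; [k <= 2] counts derivatives in [x]. *)
Definition kernel1 k (b : bool) t x y : R :=
  dgaussian k t (x - y) - b%:R * dgaussian k t (x + y).

Lemma is_derive_kernel1 k b t x y : (k < 2)%N -> 0 < t ->
  is_derive x 1 (fun x => kernel1 k b t x y) (kernel1 k.+1 b t x y).
Proof.
move=> k2 t0.
have h z : is_derive z 1 (dgaussian k t) (dgaussian k.+1 t z).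
  case: k k2 => [_|[_|//]]; last exact: is_derive_dgaussian.
  apply: (is_derive_eq (_ : is_derive z 1 _ (dgaussian 1 t z))) => //.
  rewrite (_ : dgaussian 0 t = gaussian t); first exact: is_derive_gaussian.
  by apply/funext => ?; rewrite /dgaussian/= mul1r.
have hx c : is_derive x 1 (fun x => x + c) 1.
  apply: (is_derive_eq (is_derive_addf (is_derive_id x 1) (is_derive_cst c x 1))).
  by rewrite addr0.
have hc c := @is_derive_compf R (dgaussian k t) (fun x => x + c) x _ _ (h (x + c)) (hx c).
have H := is_derive_addf (hc (- y))
  (is_derive_oppf (is_derive_mulf (is_derive_cst (b%:R : R) x 1) (hc y))).
apply: (is_derive_eq H).
by rewrite /kernel1/= !mulr1 mul0r add0r.
Qed.

Lemma is_derive_kernel1_time b t x y : 0 < t ->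
  is_derive t 1 (fun t => kernel1 0 b t x y) (kernel1 2 b t x y).
Proof.
move=> t0.
have h z : is_derive t 1 (fun t => dgaussian 0 t z) (dgaussian 2 t z).
  rewrite (_ : (fun t => _) = (fun t => gaussian t z)).
    exact: is_derive_gaussian_time.
  by apply/funext => ?; rewrite /dgaussian/= mul1r.
rewrite /kernel1.
apply: (is_derive_eq (is_derive_addf (h (x - y))
  (is_derive_oppf (is_derive_mulf (is_derive_cst (b%:R : R) t 1) (h (x + y)))))).
by rewrite /= mul0r add0r.
Qed.

Lemma kernel1_ge0 (b : bool) t x y : 0 < t -> (b -> 0 <= x) -> (b -> 0 <= y) ->
  0 <= kernel1 0 b t x y.
Proof.
move=> t0; rewrite /kernel1 /dgaussian/= !mul1r.
case: b => /= [x0 y0|_ _]; last by rewrite mul0r subr0 ltW// gaussian_gt0.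
rewrite mul1r subr_ge0 /gaussian ler_expR lerD2l lerN2 ler_pM2r; last first.
  by rewrite invr_gt0 mulr_gt0.
by have := x0 isT; have := y0 isT; nra.
Qed.

End gaussian.

Section gaussian_continuity.
Context {R : realType} {T : Type} {F : set_system T} {FF : Filter F}.
Implicit Types (f g h : T -> R) (t x y z : R).

Lemma cvg_gaussian f g t z : 0 < t -> f p @[p --> F] --> t ->
  g p @[p --> F] --> z -> gaussian (f p) (g p) @[p --> F] --> gaussian t z.
Proof.
move=> t0 ft gz; have p0 := pi_gt0 R; rewrite /gaussian.
apply: (cvg_comp (fun p => - (ln (4 * pi * f p) / 2) - g p ^+ 2 / (4 * f p)) (@expR R));
  last exact: continuous_expR.
have q0 : 0 < 4 * pi * t by rewrite !mulr_gt0.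
have f4 c : c * f p @[p --> F] --> c * t by apply: cvgM => //; exact: cvg_cst.
apply: cvgD; apply: cvgN; apply: cvgM.
- exact: (cvg_comp _ _ (f4 (4 * pi)) (continuous_ln q0)).
- exact: cvg_cst.
- by rewrite expr2; under eq_fun do rewrite expr2; exact: cvgM.
- by apply: cvgV => //; rewrite gt_eqF// mulr_gt0.
Qed.

Lemma cvg_dgaussian k f g t z : 0 < t -> f p @[p --> F] --> t ->
  g p @[p --> F] --> z -> dgaussian k (f p) (g p) @[p --> F] --> dgaussian k t z.
Proof.
move=> t0 ft gz; apply: cvgM; last exact: cvg_gaussian.
have f4 c : c * f p @[p --> F] --> c * t by apply: cvgM => //; exact: cvg_cst.
case: k => [|[|_]] /=.
- exact: cvg_cst.
- apply: cvgN; apply: cvgM => //.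
  by apply: cvgV; [rewrite gt_eqF// mulr_gt0|exact: f4].
- apply: cvgB; apply: cvgM; last 2 first.
  + exact: cvg_cst.
  + by apply: cvgV; [rewrite gt_eqF// mulr_gt0|exact: f4].
  + by rewrite expr2; under eq_fun do rewrite expr2; exact: cvgM.
  + apply: cvgV; first by rewrite gt_eqF// mulr_gt0// exprn_gt0.
    apply: cvgM; first exact: cvg_cst.
    by rewrite expr2; under eq_fun do rewrite expr2; exact: cvgM.
Qed.

Lemma cvg_kernel1 k b f g h t x y : 0 < t -> f p @[p --> F] --> t ->
  g p @[p --> F] --> x -> h p @[p --> F] --> y ->
  kernel1 k b (f p) (g p) (h p) @[p --> F] --> kernel1 k b t x y.
Proof.
move=> t0 ft gx hy; apply: cvgB.
  by apply: cvg_dgaussian => //; exact: cvgB.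
by apply: cvgM; [exact: cvg_cst|apply: cvg_dgaussian => //; exact: cvgD].
Qed.

End gaussian_continuity.

(** * The heat kernel of Omega *)

Section kernel.
Context {R : realType} {N : nat}.
Variable m : nat.
Implicit Types (t : R) (x y : 'rV[R]_N) (i : 'I_N).

Definition hkernel t x y : R :=
  \prod_(j < N) kernel1 0 (j < m)%N t (x ord0 j) (y ord0 j).

(** For [k <= 2], the [k]-th derivative of [hkernel] in [x ord0 i]. *)
Definition dkernel i k t x y : R :=
  kernel1 k (i < m)%N t (x ord0 i) (y ord0 i) *
  \prod_(j < N | j != i) kernel1 0 (j < m)%N t (x ord0 j) (y ord0 j).

(** The prefactor (4 pi t)^(-N/2) is distributed over the N coordinates. *)
Lemma heat_kernelE t x y : 0 < t -> heat_kernel m t x y = hkernel t x y.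
Proof.
move=> t0; have p0 := pi_gt0 R; rewrite /heat_kernel /hkernel.
have -> : (4 * pi * t) `^ (- (N%:R / 2)) =
    \prod_(j < N) (4 * pi * t) `^ (- 2^-1).
  rewrite big_const_ord iter_mulr_1 -powR_mulrn ?powR_ge0// -powRrM.
  by congr (_ `^ _); rewrite mulNr mulrC.
rewrite -mulrA [X in _ * (X * _)]big_mkcond [X in _ * (_ * X)]big_mkcond/=.
rewrite -!big_split/=; apply: eq_bigr => j _.
rewrite /kernel1 /dgaussian /= !mul1r !gaussianE// !real_normK ?num_real//.
by rewrite leqNgt; case: ltnP => _ /=; ring.
Qed.

Lemma hkernel_dkernel i t x y : hkernel t x y = dkernel i 0 t x y.
Proof. by rewrite /hkernel (bigD1 i). Qed.

Lemma is_derive_dkernel i k t x y (r : R) : (k < 2)%N -> 0 < t ->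
  is_derive r 1 (fun r => dkernel i k t (x + r *: delta_mx ord0 i) y)
    (dkernel i k.+1 t (x + r *: delta_mx ord0 i) y).
Proof.
move=> k2 t0.
have E s : (x + s *: delta_mx ord0 i) ord0 i = x ord0 i + s.
  by rewrite !mxE !eqxx mulr1.
have E' s j : j != i -> (x + s *: delta_mx ord0 i) ord0 j = x ord0 j.
  by move=> /negbTE ji; rewrite !mxE eqxx ji mulr0 addr0.
set c := \prod_(j < N | j != i) kernel1 0 (j < m)%N t (x ord0 j) (y ord0 j).
have Ed l s : dkernel i l t (x + s *: delta_mx ord0 i) y =
    kernel1 l (i < m)%N t (x ord0 i + s) (y ord0 i) * c.
  by rewrite /dkernel E; congr (_ * _); apply: eq_bigr => j /E' ->.
under eq_fun do rewrite Ed.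
rewrite Ed.
have hx : is_derive r 1 (fun s => x ord0 i + s) 1.
  apply: (is_derive_eq (is_derive_addf (is_derive_cst (x ord0 i) r 1) (is_derive_id r 1))).
  by rewrite add0r.
have H := @is_derive_compf R (fun z => kernel1 k (i < m)%N t z (y ord0 i))
  (fun s => x ord0 i + s) r _ _ (is_derive_kernel1 _ _ _ k2 t0) hx.
apply: (is_derive_eq (is_derive_mulf H (is_derive_cst c r 1))).
by rewrite mulr0 addr0 mulr1.
Qed.

Lemma is_derive_hkernel_time t x y : 0 < t ->
  is_derive t 1 (fun t => hkernel t x y) (\sum_(i < N) dkernel i 2 t x y).
Proof.
by move=> t0; apply: is_derive_prodf => i; exact: is_derive_kernel1_time.
Qed.

Section cvg.
Context {T : Type} {F : set_system T} {FF : Filter F}.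
Variables (f : T -> R) (g h : T -> 'rV[R]_N) (t : R) (x y : 'rV[R]_N).
Hypothesis t0 : 0 < t.
Hypothesis ft : f p @[p --> F] --> t.
Hypothesis gx : g p @[p --> F] --> x.
Hypothesis hy : h p @[p --> F] --> y.

Let cvg_coord (w : T -> 'rV[R]_N) (z : 'rV[R]_N) i : w p @[p --> F] --> z ->
  w p ord0 i @[p --> F] --> z ord0 i.
Proof.
move=> wz; exact: (cvg_comp w _ wz (@coord_continuous R 1 N ord0 i z)).
Qed.

Lemma cvg_dkernel i k : dkernel i k (f p) (g p) (h p) @[p --> F] -->
  dkernel i k t x y.
Proof.
apply: cvgM; first by apply: cvg_kernel1 => //; exact: cvg_coord.
apply: cvg_big => [|j _]; first exact: mul_continuous.
by apply: cvg_kernel1 => //; exact: cvg_coord.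
Qed.

Lemma cvg_hkernel : hkernel (f p) (g p) (h p) @[p --> F] --> hkernel t x y.
Proof.
apply: cvg_big => [|j _]; first exact: mul_continuous.
by apply: cvg_kernel1 => //; exact: cvg_coord.
Qed.

End cvg.

Lemma hkernel_ge0 t x y : 0 < t -> Omega m x -> Omega m y -> 0 <= hkernel t x y.
Proof.
move=> t0 xO yO; apply: prodr_ge0 => j _.
by apply: kernel1_ge0 => // jm; apply: ltW; [exact: xO|exact: yO].
Qed.

End kernel.

(** * Derivatives at a maximum *)

Section extrema.
Context {R : realType}.
Implicit Types (f g : R -> R) (a c d e t r : R).

(** Derivatives give information near a point through their difference quotients;
this form leaves the choice of the sign of the increment to its user. *)
Lemma is_derive_diffquot_near f t c (P : R -> Prop) : is_derive t 1 f c ->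
  (\forall y \near c, P y) ->
  exists2 e, 0 < e & forall r, r != 0 -> `|r| < e -> P (r^-1 * (f (t + r) - f t)).
Proof.
move=> [df dfc] Pc; have : (fun h : R => h^-1 *: (f (h *: 1 + t) - f t)) @ 0^' --> c.
  by rewrite -dfc; exact: df.
move=> /(_ _ Pc)[e /= e0 he]; exists e => // r r0 re.
have /= := he r; rewrite sub0r normrN /GRing.scale/= mulr1 [r + t]addrC.
exact.
Qed.

(** One-sided, because the maximum may be attained at the final time. *)
Lemma derive_ge0_left_max f a t c : a < t -> is_derive t 1 f c ->
  (forall s, a < s <= t -> f s <= f t) -> 0 <= c.
Proof.
move=> at0 dfc fmax; rewrite leNgt; apply/negP => c0.
have [|e e0 he] := is_derive_diffquot_near (P := fun y => y < 0) dfc.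
  exact: lt_nbhsl.
pose r := Num.min e (t - a) / 2.
have r0 : 0 < r by rewrite divr_gt0// lt_min e0 subr_gt0.
have re : r < e by rewrite /r; have : Num.min e (t - a) <= e by [rewrite ge_min lexx]; lra.
have ra : r < t - a by rewrite /r;
  have : Num.min e (t - a) <= t - a by [rewrite ge_min lexx orbT]; lra.
have := he (- r); rewrite oppr_eq0 gt_eqF// normrN gtr0_norm// => /(_ isT re).
rewrite invrN mulNr oppr_lt0 pmulr_rgt0 ?invr_gt0// subr_gt0 ltNge fmax//.
by apply/andP; split; lra.
Qed.

(** If the second derivative were positive, the first one, which vanishes at 0,
would be positive just to the right of 0, and [f] would increase there. *)
Lemma derive2_le0_max f f1 c d : 0 < d ->
  (forall r, `|r| < d -> is_derive r 1 f (f1 r)) -> is_derive (0 : R) 1 f1 c ->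
  (forall r, `|r| < d -> f r <= f 0) -> c <= 0.
Proof.
move=> d0 df df1 fmax; rewrite leNgt; apply/negP => c0.
have f10 : f1 0 = 0.
  have d00 : `|0 : R| < d by rewrite normr0.
  suff [_ E] : is_derive (0 : R) 1 f 0 by have [_ <-] := df 0 d00.
  apply: (@derive1_at_max R f (- d) d 0) => [| r|| r]; rewrite ?in_itv/=.
  - lra.
  - by rewrite -ltr_norml => /df[].
  - by rewrite oppr_lt0 d0.
  - by rewrite -ltr_norml => /fmax.
have [|e e0 he] := is_derive_diffquot_near (P := fun y => 0 < y) df1.
  exact: lt_nbhsr.
pose r := Num.min e d / 2.
have r0 : 0 < r by rewrite divr_gt0// lt_min e0.
have re : r < e by rewrite /r; have : Num.min e d <= e by [rewrite ge_min lexx]; lra.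
have rd : r < d by rewrite /r;
  have : Num.min e d <= d by [rewrite ge_min lexx orbT]; lra.
have dfr s : 0 <= s <= r -> is_derive s 1 f (f1 s).
  by move=> /andP[s0 sr]; apply: df; rewrite ger0_norm//; lra.
have [s|s|s + fE] := @MVT R f f1 0 r r0.
- by rewrite in_itv/= => /andP[s0 sr]; apply: dfr; rewrite !ltW.
- apply: continuous_in_subspaceT => z; rewrite inE/= in_itv/= => /dfr[dfz _].
  exact/differentiable_continuous/derivable1_diffP.
rewrite in_itv/= => /andP[s0 sr].
have := he s; rewrite gt_eqF// gtr0_norm// add0r f10 subr0.
move=> /(_ isT (lt_trans sr re)); rewrite pmulr_rgt0 ?invr_gt0// => f1s.
have : f r <= f 0 by apply: fmax; rewrite gtr0_norm.
by rewrite -subr_le0 fE subr0 leNgt mulr_gt0.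
Qed.

End extrema.

(** * The flow of the absorption equation *)

Section absorption_flow.
Context {R : realType}.
Variable alpha : R.
Hypothesis alpha0 : 0 < alpha.
Implicit Types (t s v w : R).

(* v^(-alpha) + alpha s: for v' = - v^(1 + alpha) it is v^(-alpha) that grows
   linearly in time. *)
Let S s v := expR (- alpha * ln v) + alpha * s.

Let S_gt0 s v : 0 <= s -> 0 < S s v.
Proof. by move=> s0; rewrite ltr_pwDl ?expR_gt0// mulr_ge0// ltW. Qed.

(** The solution at time [s] of v' = - v^(1 + alpha) started at [v], written
(v^(-alpha) + alpha s)^(-1/alpha); [absorbE] gives the usual form. *)
Definition absorb s v : R := expR (- alpha^-1 * ln (S s v)).

(** The derivative of [absorb] in [v].  In this form it is visibly decreasing in
[v], which is the concavity of [absorb]. *)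
Definition absorb_slope s v : R :=
  expR (- (alpha^-1 + 1) * ln (1 + alpha * s * expR (alpha * ln v))).

Lemma absorb_gt0 s v : 0 < absorb s v.
Proof. exact: expR_gt0. Qed.

Let slopeE s v : 0 <= s -> expR (- (alpha^-1 + 1) * ln (S s v)) *
  expR (- (alpha + 1) * ln v) = absorb_slope s v.
Proof.
move=> s0; rewrite /absorb_slope -expRD; congr expR.
have -> : 1 + alpha * s * expR (alpha * ln v) = S s v * expR (alpha * ln v).
  rewrite /S mulrDl -expRD; congr (_ + _).
  by rewrite mulNr addNr expR0.
rewrite lnM ?posrE ?expR_gt0 ?S_gt0// expRK.
by field; rewrite gt_eqF.
Qed.

Lemma absorbE s v : 0 <= s -> 0 < v ->
  absorb s v = v / (1 + alpha * s * v `^ alpha) `^ alpha^-1.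
Proof.
move=> s0 v0; have E0 : 0 < 1 + alpha * s * v `^ alpha.
  by rewrite ltr_pwDl// !mulr_ge0 ?powR_ge0// ltW.
rewrite -powRN {1}/powR gt_eqF// -[X in X * _](@lnK R) ?posrE// -expRD.
congr expR.
have -> : 1 + alpha * s * v `^ alpha = S s v * expR (alpha * ln v).
  rewrite /S mulrDl -expRD /powR gt_eqF//; congr (_ + _).
  by rewrite mulNr addNr expR0.
rewrite lnM ?posrE ?expR_gt0 ?S_gt0// expRK.
by field; rewrite gt_eqF.
Qed.

Lemma absorb0 v : 0 < v -> absorb 0 v = v.
Proof.
move=> v0; rewrite absorbE//.
by rewrite mulr0 mul0r addr0 powR1 divr1.
Qed.

(** The chain rule along a path [V], where the explicit dependence on time gives
the absorption term. *)
Lemma is_derive_absorb_path t0 (V : R -> R) t v' : t0 <= t -> 0 < V t ->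
  is_derive t 1 V v' ->
  is_derive t 1 (fun t => absorb (t - t0) (V t))
    (absorb_slope (t - t0) (V t) * v'
     - absorb (t - t0) (V t) `^ alpha * absorb (t - t0) (V t)).
Proof.
move=> t0t Vt0 dV; have s0 : 0 <= t - t0 by rewrite subr_ge0.
have d1 := is_derive_mulf (is_derive_cst (- alpha) t 1)
  (@is_derive_compf R (@ln R) V t _ _ (is_derive1_ln Vt0) dV).
have d2 := @is_derive_compf R (@expR R) _ t _ _ (is_derive_expR _) d1.
have d3 := is_derive_mulf (is_derive_cst alpha t 1)
  (is_derive_addf (is_derive_id t 1) (is_derive_cst (- t0) t 1)).
have d4 := @is_derive_compf R (@ln R) _ t _ _ (is_derive1_ln (S_gt0 (V t) s0))
  (is_derive_addf d2 d3).
have d5 := @is_derive_compf R (@expR R) _ t _ _ (is_derive_expR _)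
  (is_derive_mulf (is_derive_cst (- alpha^-1) t 1) d4).
apply: (is_derive_eq d5); rewrite /= -/(S (t - t0) (V t)) -slopeE//.
have SE : (S (t - t0) (V t))^-1 = expR (- ln (S (t - t0) (V t))).
  by rewrite expRN lnK// posrE S_gt0.
have VE : (V t)^-1 = expR (- ln (V t)) by rewrite expRN lnK.
rewrite SE VE /powR gt_eqF ?absorb_gt0// /absorb expRK.
have -> : expR (- (alpha^-1 + 1) * ln (S (t - t0) (V t))) =
    expR (- alpha^-1 * ln (S (t - t0) (V t))) * expR (- ln (S (t - t0) (V t))).
  by rewrite -expRD; congr expR; ring.
have -> : expR (- (alpha + 1) * ln (V t)) =
    expR (- alpha * ln (V t)) * expR (- ln (V t)).
  by rewrite -expRD; congr expR; ring.
have -> : alpha * (- alpha^-1 * ln (S (t - t0) (V t))) = - ln (S (t - t0) (V t)).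
  by field; rewrite gt_eqF.
set l := ln (V t); set q := ln (S _ _).
pose A : R := expR (- alpha * l); pose B : R := expR (- alpha^-1 * q).
pose C : R := expR (- q); pose D : R := expR (- l).
change (B * (0 * q + - alpha^-1 * (C * (A * (0 * l + - alpha * (D * v'))
  + (0 * (t - t0) + alpha * (1 + 0))))) = B * C * (A * D) * v' - C * B).
by clearbody A B C D; field; rewrite gt_eqF.
Qed.

Lemma is_derive_absorb s v : 0 <= s -> 0 < v ->
  is_derive v 1 (absorb s) (absorb_slope s v).
Proof.
move=> s0 v0.
have d1 := is_derive_mulf (is_derive_cst (- alpha) v 1) (is_derive1_ln v0).
have d2 := @is_derive_compf R (@expR R) _ v _ _ (is_derive_expR _) d1.
have d4 := @is_derive_compf R (@ln R) _ v _ _ (is_derive1_ln (S_gt0 v s0))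
  (is_derive_addf d2 (is_derive_cst (alpha * s) v 1)).
have d5 := @is_derive_compf R (@expR R) _ v _ _ (is_derive_expR _)
  (is_derive_mulf (is_derive_cst (- alpha^-1) v 1) d4).
apply: (is_derive_eq d5); rewrite /= -/(S s v) -slopeE//.
have SE : (S s v)^-1 = expR (- ln (S s v)) by rewrite expRN lnK// posrE S_gt0.
have VE : v^-1 = expR (- ln v) by rewrite expRN lnK.
rewrite SE VE.
have -> : expR (- (alpha^-1 + 1) * ln (S s v)) =
    expR (- alpha^-1 * ln (S s v)) * expR (- ln (S s v)).
  by rewrite -expRD; congr expR; ring.
have -> : expR (- (alpha + 1) * ln v) = expR (- alpha * ln v) * expR (- ln v).
  by rewrite -expRD; congr expR; ring.
set l := ln v; set q := ln (S _ _).
pose A : R := expR (- alpha * l); pose B : R := expR (- alpha^-1 * q).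
pose C : R := expR (- q); pose D : R := expR (- l).
change (B * (0 * q + - alpha^-1 * (C * (A * (0 * l + - alpha * D) + 0)))
  = B * C * (A * D)).
by clearbody A B C D; field; rewrite gt_eqF.

Qed.

Lemma absorb_slope_le s v w : 0 <= s -> 0 < v -> v <= w ->
  absorb_slope s w <= absorb_slope s v.
Proof.
move=> s0 v0 vw; have w0 := lt_le_trans v0 vw.
have E0 x : 0 < 1 + alpha * s * expR (alpha * ln x).
  by rewrite ltr_pwDl// !mulr_ge0 ?expR_ge0// ltW.
rewrite ler_expR !mulNr lerN2 ler_pM2l; last by rewrite addr_gt0// invr_gt0.
rewrite ler_ln ?posrE// lerD2l ler_wpM2l//; first by rewrite mulr_ge0// ltW.
by rewrite ler_expR ler_pM2l// ler_ln.
Qed.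

(** Concavity, from the mean value theorem and the monotonicity of the slope. *)
Lemma absorb_le_tangent s v w : 0 <= s -> 0 < v -> 0 < w ->
  absorb s w <= absorb s v + absorb_slope s v * (w - v).
Proof.
move=> s0 v0 w0; have [->|wv] := eqVneq w v; first by rewrite subrr mulr0 addr0.
have MVTp a b : 0 < a -> a < b -> exists2 c, c \in `]a, b[ &
    absorb s b - absorb s a = absorb_slope s c * (b - a).
  move=> a0 ab; apply: MVT => // [x|].
    rewrite in_itv/= => /andP[ax _].
    by apply: is_derive_absorb => //; exact: lt_trans ax.
  apply: continuous_in_subspaceT => z; rewrite inE/= in_itv/= => /andP[az _].
  have [dz _] := is_derive_absorb s0 (lt_le_trans a0 az).
  exact/differentiable_continuous/derivable1_diffP.
case: (ltgtP w v) wv => // wv _.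
  have [c] := MVTp _ _ w0 wv; rewrite in_itv/= => /andP[wc cv] E.
  have wv0 : 0 <= v - w by rewrite subr_ge0 ltW.
  move: (ler_wpM2r wv0 (absorb_slope_le s0 (lt_trans w0 wc) (ltW cv))) E.
  generalize (absorb_slope s c) (absorb_slope s v) (absorb s v) (absorb s w).
  by move=> p q X Y h E; rewrite -E in h; rewrite -[w - v]opprB mulrN; lra.
have [c] := MVTp _ _ v0 wv; rewrite in_itv/= => /andP[vc cw] E.
have wv0 : 0 <= w - v by rewrite subr_ge0 ltW.
move: (ler_wpM2r wv0 (absorb_slope_le s0 v0 (ltW vc))) E.
generalize (absorb_slope s c) (absorb_slope s v) (absorb s v) (absorb s w).
by move=> p q X Y h E; rewrite -E in h; lra.
Qed.

Lemma absorb_le s v w : 0 <= s -> 0 < v -> v <= w -> absorb s v <= absorb s w.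
Proof.
move=> s0 v0 vw; have w0 := lt_le_trans v0 vw.
rewrite ler_expR !mulNr lerN2 ler_pM2l ?invr_gt0// ler_ln ?posrE ?S_gt0//.
by rewrite lerD2r ler_expR !mulNr lerN2 ler_pM2l// ler_ln.
Qed.

Lemma cvg_absorb (T : Type) (F : set_system T) (FF : Filter F) (f g : T -> R) s v :
  0 <= s -> 0 < v -> f p @[p --> F] --> s -> g p @[p --> F] --> v ->
  absorb (f p) (g p) @[p --> F] --> absorb s v.
Proof.
move=> s0 v0 fs gv.
have cexp (h : T -> R) x : h p @[p --> F] --> x -> expR (h p) @[p --> F] --> expR x.
  by move=> hx; apply: (cvg_comp h (@expR R) hx); exact: continuous_expR.
apply: (cexp); apply: cvgM; first exact: cvg_cst.
apply: (@cvg_comp _ _ _ (fun p => S (f p) (g p)) (@ln R) F (nbhs (S s v))).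
  apply: cvgD; last by apply: cvgM => //; exact: cvg_cst.
  apply: cexp; apply: cvgM; first exact: cvg_cst.
  exact: (cvg_comp g (@ln R) gv (continuous_ln v0)).
exact: continuous_ln (S_gt0 v s0).
Qed.

End absorption_flow.

(** * Topology of Omega and continuity of solutions *)

Section domain.
Context {R : realType} {N : nat}.
Variable m : nat.
Implicit Types (x y : 'rV[R]_N) (i : 'I_N).

Lemma open_Omega : open (@Omega R N m).
Proof.
rewrite openE => x xO.
suff h i : nbhs x (fun y : 'rV[R]_N => (i < m)%N -> 0 < y ord0 i).
  exact: (filter_forall _ h).
have [im|im] := boolP (i < m)%N; last first.
  by apply: (@filterE _ (nbhs x)) => y; move: im => /negP.
have := @coord_continuous R 1 N ord0 i x.
move=> /(_ [set z | 0 < z]) /= h.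
have {}h : \forall y \near x, 0 < (y : 'rV[R]_N) ord0 i by apply: h; exact: lt_nbhsr (xO i im).
by apply: filterS h => y y0 _.
Qed.

Lemma coord_le_enorm x i : `|x ord0 i| <= enorm x.
Proof.
rewrite -sqrtr_sqr ler_sqrt ?sumr_ge0// => [|j _]; last exact: sqr_ge0.
by rewrite (bigD1 i)//= lerDl sumr_ge0// => j _; exact: sqr_ge0.
Qed.

(** A closed ball of the sup norm.  Its compactness is that of a product of
segments, and its measure is explicit. *)
Definition cube (M : R) : set 'rV[R]_N := [set x | forall i, `|x ord0 i| <= M].

Lemma compact_cube M : compact (cube M).
Proof.
rewrite (_ : cube M = [set x | forall i, `[- M, M]%classic (x ord0 i)]).
  by apply: (@rV_compact R N (fun=> `[- M, M]%classic)) => _; exact: segment_compact.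
by apply/seteqP; split => x xM i; have := xM i; rewrite /= in_itv/= ler_norml.
Qed.

Lemma enorm_notin_cube M x : ~ cube M x -> M < enorm x.
Proof.
move=> xM; have [//|Mx] := ltP M (enorm x); exfalso; apply: xM => i.
exact: le_trans (coord_le_enorm x i) Mx.
Qed.

Lemma cube_enorm x : cube (enorm x) x.
Proof. exact: coord_le_enorm. Qed.

Lemma cube_le M M' : M <= M' -> cube M `<=` cube M'.
Proof. by move=> MM' x xM i; exact: le_trans (xM i) MM'. Qed.

Lemma near_line x i d : open d -> d x ->
  \forall r \near 0, d (x + (r : R) *: delta_mx ord0 i).
Proof.
move=> od dx; have : x + (r : R) *: delta_mx ord0 i @[r --> 0] --> x.
  rewrite -[X in _ --> X](_ : x + (0 : R) *: delta_mx ord0 i = _); last first.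
    by rewrite scale0r addr0.
  by apply: cvgD; [exact: cvg_cst|apply: cvgZ; [exact: cvg_id|exact: cvg_cst]].
by move=> /(_ _ (open_nbhs_nbhs (conj od dx))).
Qed.

End domain.

Section solution.
Context {R : realType} {N : nat}.
Variables (m : nat) (gamma alpha C : R) (u0 : 'rV[R]_N -> R).
Variable u : R -> 'rV[R]_N -> R.
Hypothesis solu : is_solution m gamma alpha C u0 u.
Implicit Types (x y : 'rV[R]_N) (i : 'I_N) (t e : R).
Local Notation Om := (@Omega R N m).

(** Extension by zero.  The Dirichlet condition makes it continuous on all of
R^N, so compactness arguments need not mention the boundary. *)
Definition uext t x : R := (u t \_ Om) x.

Lemma uextE t x : Om x -> uext t x = u t x.
Proof. by move=> xO; rewrite /uext patchE mem_set. Qed.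

Lemma uext_out t x : ~ Om x -> uext t x = 0.
Proof. by move=> xO; rewrite /uext patchE memNset. Qed.

Lemma sol_near_uniform t e : 0 < t -> 0 < e ->
  \forall s \near t, forall x, closure Om x -> `|u t x - u s x| < e.
Proof.
move=> t0 e0.
have H : nbhs (u t : {uniform` closure Om -> R})
    [set h | forall x, closure Om x -> `|u t x - h x| < e].
  apply/uniform_nbhs; exists [set xy | ball xy.1 e xy.2]; split => //.
  exact: entourage_ball (PosNum e0).
exact: (sol_continuous solu t0 H).
Qed.

Lemma sol_near_boundary t x e : 0 < t -> 0 < e -> ~ Om x ->
  \forall y \near x, Om y -> `|u t y| < e.
Proof.
move=> t0 e0 xO; have [xc|xc] := pselect (closure Om x); last first.
  have : (~` closure Om) x by [].
  move=> /(conj (closed_openC (@closed_closure _ Om))) /open_nbhs_nbhs.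
  by apply: filterS => y yc yO; exfalso; apply: yc; exact: subset_closure.
have [cu bu _] := sol_C0 solu t0.
have ux0 : u t x = 0 by exact: bu.
move/subspace_continuousP : cu => /(_ _ xc) /cvgrPdist_lt /(_ _ e0).
move=> h.
have {}h : \forall y \near x, closure Om y -> `|u t x - u t y| < e by exact: h.
apply: filterS h => y; rewrite ux0 sub0r normrN => h yO.
by apply: h; exact: subset_closure.
Qed.

(** Inside Omega this is joint continuity of the solution.  At other points,
uniform convergence in time reduces the claim to a fixed time, where the solution
is small near the boundary. *)
Lemma uext_continuous t x : 0 < t ->
  uext p.1 p.2 @[p --> (t, x)] --> uext t x.
Proof.
move=> t0; have [xO|xO] := pselect (Om x).
  rewrite uextE//.
  have cu := C12_continuous (sol_classical solu) t0 xO.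
  apply: (cvg_trans _ cu); apply: near_eq_cvg.
  have : \forall p \near (t, x), Om p.2.
    exists (setT, Om); last by move=> p [].
    by split; [exact: filterT|apply: open_nbhs_nbhs; split => //; exact: open_Omega].
  by apply: filterS => p pO /=; rewrite uextE.
rewrite uext_out//; apply/cvgrPdist_lt => e e0.
have e20 : 0 < e / 2 by rewrite divr_gt0.
exists ([set s | forall x, closure Om x -> `|u t x - u s x| < e / 2],
  [set y | Om y -> `|u t y| < e / 2]).
  by split; [exact: sol_near_uniform|exact: sol_near_boundary].
move=> [s y] /= [h1 h2]; rewrite sub0r normrN.
have [yO|yO] := pselect (Om y); last by rewrite uext_out// normr0.
rewrite uextE// -[u s y](subKr (u t y)) (le_lt_trans (ler_normB _ _))//.
by rewrite (splitr e) ltrD//; [exact: h2|apply: h1; exact: subset_closure].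
Qed.

Lemma uext_continuous_space t : 0 < t -> continuous (uext t).
Proof.
move=> t0 x.
apply: (@continuous2_cvg _ _ _ _ _ (nbhs_filter x) (cst t) id uext t x).
- exact: uext_continuous.
- exact: cvg_cst.
- exact: cvg_id.
Qed.

(** Decay at infinity at one time passes to nearby times by uniform convergence,
and then to a compact time interval by covering it. *)
Lemma sol_decay_uniform a b e : 0 < a -> 0 < e ->
  exists M, forall t x, a <= t <= b -> Om x -> M < enorm x -> `|u t x| < e.
Proof.
move=> a0 e0; have e20 : 0 < e / 2 by rewrite divr_gt0.
have /compact_near_coveringP cov := @segment_compact R a b.
have [|M [_ /(_ (M + 1))]] := cov _ (+oo)%R
  (fun M t => forall x, Om x -> M < enorm x -> `|u t x| < e) _ _.
  move=> t; rewrite /= in_itv/= => /andP[at_ tb].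
  have t0 := lt_le_trans a0 at_.
  have [_ _ /(_ _ e20)[M hM]] := sol_C0 solu t0.
  exists ([set s | forall x, closure Om x -> `|u t x - u s x| < e / 2],
    [set M' | M <= M']).
    by split; [exact: sol_near_uniform|exact: nbhs_pinfty_ge (num_real _)].
  move=> [s M'] /= [h1 h2] x xO xM.
  rewrite -[u s x](subKr (u t x)) (le_lt_trans (ler_normB _ _))//.
  rewrite (splitr e) ltrD//; first by apply: hM => //; exact: le_lt_trans xM.
  by apply: h1; exact: subset_closure.
rewrite ltrDl ltr01 => /(_ isT) h; exists (M + 1) => t x tab xO xM.
by apply: (h t) => //; rewrite /= in_itv.
Qed.

End solution.

(** * Comparison with the absorbed heat flow *)

Section comparison.
Context {R : realType} {N : nat}.
Variables (m : nat) (gamma alpha C : R) (u0 : 'rV[R]_N -> R).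
Variable u : R -> 'rV[R]_N -> R.
Hypothesis solu : is_solution m gamma alpha C u0 u.
Hypothesis alpha0 : 0 < alpha.
Implicit Types (x y : 'rV[R]_N) (i : 'I_N) (t : R).
Local Notation Om := (@Omega R N m).
Local Notation uext := (uext m u).

Lemma is_derive_line (f : 'rV[R]_N -> R) x (v : 'rV[R]_N) (r : R) :
  derivable f (x + r *: v) v ->
  is_derive r 1 (fun s : R => f (x + s *: v)) ('D_v f (x + r *: v)).
Proof.
move=> df.
have E : (fun h : R => h^-1 *: (f (x + (h *: 1 + r) *: v) - f (x + r *: v))) =
         (fun h : R => h^-1 *: (f (h *: v + (x + r *: v)) - f (x + r *: v))).
  apply/funext => h; congr (_ *: (f _ - _)).
  by rewrite scalerDl /GRing.scale/= mulr1 addrCA.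
split; first by rewrite /derivable E.
by rewrite /derive E.
Qed.

(* A solution V of the heat equation on Omega for times in ]a, b], with space
   derivatives D1 and D2, which stays above e > 0 and dominates u at time a. *)
Variables (V : R -> 'rV[R]_N -> R) (D1 D2 : 'I_N -> R -> 'rV[R]_N -> R).
Variables (a b e : R).
Hypotheses (a0 : 0 < a) (ab : a <= b) (e0 : 0 < e).
Hypothesis V_continuous : forall t x, a <= t <= b ->
  V p.1 p.2 @[p --> (t, x)] --> V t x.
Hypothesis V_ge : forall t x, a <= t <= b -> Om x -> e <= V t x.
Hypothesis V_derive1 : forall i t x (r : R), a < t <= b ->
  is_derive r 1 (fun r : R => V t (x + r *: delta_mx ord0 i))
    (D1 i t (x + r *: delta_mx ord0 i)).
Hypothesis V_derive2 : forall i t x (r : R), a < t <= b ->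
  is_derive r 1 (fun r : R => D1 i t (x + r *: delta_mx ord0 i))
    (D2 i t (x + r *: delta_mx ord0 i)).
Hypothesis V_heat : forall t x, a < t <= b ->
  is_derive t 1 (V ^~ x) (\sum_(i < N) D2 i t x).
Hypothesis V_init : forall x, Om x -> u a x <= V a x.

Let A t x := absorb alpha (t - a) (V t x).

(** At a positive maximum of u - w with w = [A], tangency turns it into a maximum of
u - q V in space, whence Delta u <= q Delta V; in time, u_t >= w_t.  The heat
equation for V cancels these terms and leaves u^(1 + alpha) <= w^(1 + alpha). *)
Let no_interior_max t x : a < t <= b -> Om x -> A t x < u t x ->
  (forall s y, a <= s <= b -> Om y -> u s y - A s y <= u t x - A t x) -> False.
Proof.
move=> /andP[at_ tb] xO Au umax.
have t0 : 0 < t by exact: lt_trans at_.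
have tab : a <= t <= b by rewrite (ltW at_).
have tab' : a < t <= b by rewrite at_.
have s0 : 0 <= t - a by rewrite subr_ge0 ltW.
have V0 y : Om y -> 0 < V t y by move=> yO; exact: lt_le_trans (V_ge tab yO).
have cu := sol_classical solu.
pose q := absorb_slope alpha (t - a) (V t x).
have space i : dx i (dx i u) t x <= q * D2 i t x.
  have /nbhs_ballP[d /= d0 hd] := near_line i (@open_Omega R N m) xO.
  have xE : x + (0 : R) *: delta_mx ord0 i = x by rewrite scale0r addr0.
  (* The restriction of u - q V to the line through x in the direction i. *)
  pose f (r : R) := u t (x + r *: delta_mx ord0 i) - q * V t (x + r *: delta_mx ord0 i).
  pose f1 (r : R) := dx i u t (x + r *: delta_mx ord0 i)
    - q * D1 i t (x + r *: delta_mx ord0 i).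
  have hO (r : R) : `|r| < d -> Om (x + r *: delta_mx ord0 i).
    by move=> rd; apply: hd; rewrite /ball/= sub0r normrN.
  rewrite -subr_le0; apply: (@derive2_le0_max R f f1 _ d) => // [r rd||r rd].
  - have H := is_derive_addf (is_derive_line (C12_derivable_x (i := i) cu t0 (hO r rd)))
      (is_derive_oppf (is_derive_mulf (is_derive_cst q r 1) (V_derive1 i x r tab'))).
    by apply: (is_derive_eq H); rewrite mul0r add0r.
  - have Hd : derivable (dx i u t) (x + (0 : R) *: delta_mx ord0 i) (delta_mx ord0 i).
      by rewrite xE; exact: (C12_derivable_xx cu).
    have H := is_derive_addf (is_derive_line Hd)
      (is_derive_oppf (is_derive_mulf (is_derive_cst q (0 : R) 1) (V_derive2 i x 0 tab'))).
    by apply: (is_derive_eq H); rewrite mul0r add0r xE.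
  - rewrite /f xE; set y := x + _; have yO : Om y by exact: hO.
    have := absorb_le_tangent alpha0 s0 (V0 _ xO) (V0 _ yO).
    have := umax t y tab yO; rewrite -/q /A mulrBr; set X := absorb _ _ _.
    set Y := absorb _ _ _; move: X Y => X Y; lra.
have time : 0 <= dt u t x - (q * (\sum_(i < N) D2 i t x) - A t x `^ alpha * A t x).
  have dtu : is_derive t 1 (u ^~ x) (dt u t x).
    by rewrite /dt derive1E; apply: derivableP; exact: (C12_derivable_t cu).
  have H := is_derive_addf dtu (is_derive_oppf
    (is_derive_absorb_path alpha0 (ltW at_) (V0 _ xO) (V_heat x tab'))).
  apply: (derive_ge0_left_max at_ H) => s /andP[as_ st].
  by apply: umax => //; rewrite (ltW as_) (le_trans st).
have A0 : 0 < A t x := absorb_gt0 _ _ _.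
have ut0 : 0 < u t x := lt_trans A0 Au.
have := sol_equation solu t0 xO; rewrite (gtr0_norm ut0).
have lap : laplacian u t x <= q * (\sum_(i < N) D2 i t x).
  by rewrite mulr_sumr; apply: ler_sum => i _.
have : A t x `^ alpha * A t x < u t x `^ alpha * u t x.
  by apply: ltr_pM; rewrite ?powR_ge0 ?(ltW A0)//; apply: gt0_ltr_powR;
    rewrite ?nnegrE ?ltW.
move: lap time; set X := _ `^ _ * _; set Y := _ `^ _ * _; set Z := q * _.
by move: X Y Z => X Y Z; lra.
Qed.

(** A positive maximum of u - w exists as soon as u - w is positive somewhere: u
vanishes on the boundary and at infinity, and w > 0.  It is not attained at time
[a], and [no_interior_max] excludes the later times. *)
Lemma comparison x : Om x -> u b x <= absorb alpha (b - a) (V b x).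
Proof.
move=> xO; rewrite leNgt; apply/negP => ux.
(* V may be negative off Omega; W equals V on Omega and keeps w continuous and
   positive on the whole space. *)
pose W t y := Num.max (V t y) e.
have WV t y : a <= t <= b -> Om y -> W t y = V t y.
  by move=> tab yO; apply/max_idPl; exact: V_ge.
pose Z (p : R * 'rV[R]_N) := uext p.1 p.2 - absorb alpha (p.1 - a) (W p.1 p.2).
have ZE t y : a <= t <= b -> Om y -> Z (t, y) = u t y - A t y.
  by move=> tab yO; rewrite /Z/= (uextE _ _ yO) (WV _ _ tab yO).
have bab : a <= b <= b by rewrite ab lexx.
pose z := Z (b, x).
have z0 : 0 < z by rewrite /z ZE// subr_gt0.
have [M hM] := sol_decay_uniform solu b a0 z0.
pose M' := Num.max M (enorm x).
have cK : compact (`[a, b]%classic `*` (cube M' : set 'rV[R]_N)).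
  by apply: compact_setX; [exact: segment_compact|exact: compact_cube].
have Kx : (`[a, b]%classic `*` cube M') (b, x).
  split; rewrite /= ?in_itv/= ?ab ?lexx//.
  by apply: (cube_le _ (@cube_enorm _ _ x)); rewrite le_max lexx orbT.
have [|[t y]] := @compact_EVT_max _ _ Z _ (ex_intro _ _ Kx) cK.
  apply/subspace_continuousP => -[t y] [/= + _].
  rewrite in_itv/= => tab; have /andP[at_ tb] := tab.
  apply: cvg_within_filter; apply: cvgB.
    by apply: (uext_continuous solu); exact: lt_le_trans at_.
  apply: cvg_absorb => //=.
  - by rewrite subr_ge0.
  - by rewrite lt_max e0 orbT.
  - by apply: cvgB; [exact: cvg_fst|exact: cvg_cst].
  - apply: (@continuous2_cvg _ _ _ _ _ (nbhs_filter (t, y))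
      (fun p : R * 'rV[R]_N => V p.1 p.2) (cst e) Num.max (V t y) e).
    + exact: (@max_continuous _ R (V t y, e)).
    + exact: V_continuous.
    + exact: cvg_cst.
rewrite inE => -[/=]; rewrite in_itv/= => tab _ Zmax.
have zZ : z <= Z (t, y) by apply: Zmax; rewrite inE.
have yO : Om y.
  apply: contrapT => yO; have := lt_le_trans z0 zZ.
  by rewrite /Z/= uext_out// sub0r oppr_gt0 ltNge (ltW (absorb_gt0 _ _ _)).
have at_ : a < t.
  rewrite lt_neqAle; have /andP[-> _] := tab; rewrite andbT; apply/eqP => ta.
  have aab : a <= a <= b by rewrite lexx.
  have := lt_le_trans z0 zZ; rewrite ZE// subr_gt0 /A -ta subrr.
  by rewrite (absorb0 alpha0 (lt_le_trans e0 (V_ge aab yO))) ltNge V_init.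
apply: (@no_interior_max t y _ yO).
- by rewrite at_; case/andP : tab.
- by have := lt_le_trans z0 zZ; rewrite (ZE _ _ tab yO) subr_gt0.
move=> s w sab wO; rewrite -(ZE _ _ sab wO) -(ZE _ _ tab yO).
have [wK|/enorm_notin_cube wK] := pselect (cube M' w).
  by apply: Zmax; rewrite inE; split => //=; rewrite in_itv.
apply: le_trans zZ; rewrite (ZE _ _ sab wO) lerBlDr.
apply: (@le_trans _ _ z); last by rewrite lerDl ltW// absorb_gt0.
apply: le_trans (ler_norm _) (ltW (hM s w sab wO _)).
by apply: le_lt_trans wK; rewrite le_max lexx.
Qed.

End comparison.

(** * Integrals depending on a parameter *)

Section parametric_integrals.
Context {R : realType} {N : nat}.
Local Notation mu := (lebesgue_rV R N).
Implicit Types (y : 'rV[R]_N).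

Lemma cube_itv (r : R) :
  cube r = [set x : 'rV[R]_N | forall i, `[- r, r]%classic (x ord0 i)].
Proof.
by apply/seteqP; split => x /= h i; have := h i; rewrite /= in_itv/= ler_norml.
Qed.

Lemma measurable_cube r : measurable (cube r : set 'rV[R]_N).
Proof.
rewrite cube_itv (_ : mkset _ = \bigcap_(i in [set: 'I_N])
    [set x : 'rV[R]_N | `[- r, r]%classic (x ord0 i)]).
  apply: fin_bigcap_measurable => // i _; rewrite -[X in measurable X]setTI.
  by apply: (measurable_coord i measurableT); exact: measurable_itv.
by apply/seteqP; split => x /= h i => [_|]; exact: h.
Qed.

Lemma lebesgue_rV_cube (r : R) : 0 <= r -> mu (cube r) = ((2 * r) ^+ N)%:E.
Proof.
move=> r0; rewrite cube_itv (@lebesgue_rV_box R N (fun=> `[- r, r]%classic))//.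
rewrite (eq_bigr (fun=> (2 * r)%:E)) => [|i _]; last first.
  rewrite lebesgue_measure_itv/= lte_fin; case: ltP => rr; rewrite -?EFinD.
    by congr (_%:E); lra.
  by congr (_%:E); lra.
by rewrite prodEFin big_const_ord iter_mulr_1.
Qed.

Variables (M : R).
Hypothesis M0 : 0 <= M.

(** The integrand is bounded on a set of finite measure. *)
Lemma integrable_cube_support (g : 'rV[R]_N -> R) : continuous g ->
  (forall y, ~ cube M y -> g y = 0) -> mu.-integrable setT (EFin \o g).
Proof.
move=> cg g0.
have gE : EFin \o g = (EFin \o g) \_ (cube M).
  apply/funext => y; rewrite patchE; case: ifPn => // /negP.
  by rewrite inE => /g0 /= ->.
rewrite gE; apply/(integrable_mkcond _ (measurable_cube M)).
apply: measurable_bounded_integrable.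
- exact: measurable_cube.
- have h : (mu (cube M) < +oo)%E by rewrite lebesgue_rV_cube// ltry.
  exact: h.
- by apply: measurable_funTS; exact: continuous_measurable_rV.
have cgc : {within cube M, continuous g} by exact: continuous_subspaceT.
have := compact_bounded (continuous_compact cgc (@compact_cube R N M)).
move=> [B [Br gB]]; exists B; split => // c Bc x xM.
by apply: gB Bc _ _; exists x.
Qed.

Variables (phi : 'rV[R]_N -> R).
Hypothesis phi_continuous : continuous phi.
Hypothesis phi_support : forall y, ~ cube M y -> phi y = 0.

Let norm_phi_continuous : continuous (fun y => `|phi y|).
Proof.
by move=> y; exact: (continuous_comp (@phi_continuous y) (@norm_continuous _ _ _)).
Qed.

Lemma integrable_mul_cube_support (g : 'rV[R]_N -> R) : continuous g ->
  mu.-integrable setT (EFin \o (fun y => g y * phi y)).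
Proof.
move=> cg; apply: integrable_cube_support => [y|y yM].
  exact: (continuousM (cg y) (@phi_continuous y)).
by rewrite phi_support// mulr0.
Qed.

Lemma Rintegral_sum_mul n (g : 'I_n -> 'rV[R]_N -> R) :
  (forall i, continuous (g i)) ->
  \int[mu]_y ((\sum_(i < n) g i y) * phi y) =
  \sum_(i < n) \int[mu]_y (g i y * phi y).
Proof.
elim: n g => [|n IH] g cg.
  under eq_Rintegral do rewrite big_ord0 mul0r.
  by rewrite big_ord0 Rintegral_cst// mul0r.
rewrite big_ord_recl -IH => [|i]; last exact: cg.
rewrite -RintegralD//.
- by apply: eq_Rintegral => y _; rewrite big_ord_recl mulrDl.
- exact: integrable_mul_cube_support.
- apply: integrable_mul_cube_support.
  by apply: continuous_big => [|i _]; [exact: add_continuous|exact: cg].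
Qed.

(** By compactness of the support of [phi], [F q] is close to [F p] uniformly on
that support when [q] is close to [p]. *)
Lemma continuous_integral_param (T : topologicalType) (F : T -> 'rV[R]_N -> R) p :
  (\forall q \near p, continuous (F q)) ->
  (forall y, F q.1 q.2 @[q --> (p, y)] --> F p y) ->
  \int[mu]_y (F q y * phi y) @[q --> p] --> \int[mu]_y (F p y * phi y).
Proof.
move=> cF cF2; apply/cvgrPdist_lt => e e0.
have iphi : mu.-integrable setT (EFin \o (fun y => `|phi y|)).
  apply: integrable_cube_support => [|y yM]; first exact: norm_phi_continuous.
  by rewrite phi_support// normr0.
pose I := \int[mu]_y `|phi y|.
have I0 : 0 <= I by apply: Rintegral_ge0.
pose d := e / (I + 1).
have d0 : 0 < d by rewrite divr_gt0// ltr_wpDl.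
have /compact_near_coveringP cov := @compact_cube R N M.
have near_d : \forall q \near p, cube M `<=` (fun y => `|F p y - F q y| <= d).
  apply: (cov T (nbhs p) (fun q y => `|F p y - F q y| <= d)) => y yM.
  have d20 : 0 < d / 2 by rewrite divr_gt0.
  have /cvgrPdist_lt /(_ _ d20)[[A B] /= [pA yB] AB] := cF2 y.
  exists (B, A) => // -[z q] /= [Bz Aq].
  have h1 := AB (q, z) (conj Aq Bz).
  have h2 := AB (p, z) (conj (nbhs_singleton pA) Bz).
  rewrite /= in h1 h2; rewrite [in X in `|X|](_ : F p z - F q z =
    (F p y - F q z) - (F p y - F p z)); last by ring.
  by rewrite (le_trans (ler_normB _ _))// (splitr d) lerD// ltW.
have cFp : continuous (F p) by exact: nbhs_singleton cF.
near=> q.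
have cFq : continuous (F q) by near: q.
rewrite -RintegralB//; [|exact: integrable_mul_cube_support..].
have cB : continuous (fun y => F p y * phi y - F q y * phi y).
  move=> y; exact: (continuousB (continuousM (cFp y) (@phi_continuous y))
    (continuousM (cFq y) (@phi_continuous y))).
have iB : mu.-integrable setT (EFin \o (fun y => F p y * phi y - F q y * phi y)).
  apply: integrable_cube_support => [|y yM]; first exact: cB.
  by rewrite phi_support// !mulr0 subrr.
apply: le_lt_trans (le_normr_Rintegral _ iB) _ => //.
apply: (@le_lt_trans _ _ (\int[mu]_y (d * `|phi y|))).
  apply: le_Rintegral => //.
  - apply: integrable_cube_support => [y|y yM].
      exact: (continuous_comp (cB y) (@norm_continuous _ _ _)).
    by rewrite phi_support// !mulr0 subrr normr0.
  - apply: integrable_cube_support => [y|y yM].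
      exact: (continuousM (@cst_continuous _ _ _ y) (@norm_phi_continuous y)).
    by rewrite phi_support// normr0 mulr0.
  - move=> y _; rewrite -mulrBl normrM.
    have [yM|yM] := pselect (cube M y); last by rewrite phi_support// normr0 !mulr0.
    by rewrite ler_wpM2r//; move: y yM; near: q.
rewrite RintegralZl// -/I /d mulrAC ltr_pdivrMr ?ltr_wpDl//.
by rewrite ltr_pM2l// ltrDl.
Unshelve. all: by end_near. Qed.

(** Differentiation under the integral sign.  The dominating function is a
constant multiple of [|phi|]: joint continuity bounds the derivative on the
compact support of [phi] for parameters close to [t0]. *)
Lemma is_derive_integral_param (F dF : R -> 'rV[R]_N -> R) (t0 : R) :
  (\forall t \near t0, forall y, is_derive (t : R) 1 (F ^~ y) (dF t y)) ->
  (\forall t \near t0, continuous (F t)) ->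
  (forall y, dF q.1 q.2 @[q --> (t0, y)] --> dF t0 y) ->
  is_derive t0 1 (fun t => \int[mu]_y (F t y * phi y))
    (\int[mu]_y (dF t0 y * phi y)).
Proof.
move=> dFF cF cdF.
have /compact_near_coveringP cov := @compact_cube R N M.
have [[A B] /= [At0 [b [br bB]]] AB] : \forall t \near t0 & c \near +oo,
    cube M `<=` (fun y => `|dF t y| <= c).
  pose P (q : R * R) (y : 'rV[R]_N) := `|dF q.1 y| <= q.2.
  apply: (cov _ (filter_prod (nbhs t0) (pinfty_nbhs R)) P) => y yM.
  have /cvgrPdist_lt /(_ _ ltr01)[[A B] /= [pA yB] AB] := cdF y.
  exists (B, A `*` [set c | `|dF t0 y| + 1 <= c]).
    split => //=; exists (A, [set c | `|dF t0 y| + 1 <= c]) => //.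
    by split => //; exact: nbhs_pinfty_ge (num_real _).
  move=> [z [t c]] /= [Bz [At ct]].
  have /= h := AB (t, z) (conj At Bz); rewrite /P/=.
  apply: le_trans ct; rewrite -[dF t z](subKr (dF t0 y)).
  by rewrite (le_trans (ler_normB _ _))// lerD2l ltW.
have Bc : B (`|b| + 1).
  by apply: bB; rewrite (le_lt_trans (ler_norm b))// ltrDl.
set c := `|b| + 1 in Bc.
have /nbhs_ballP[d /= d0 hd] : \forall t \near t0, [/\ A t,
    (forall y, is_derive (t : R) 1 (F ^~ y) (dF t y)) & continuous (F t)].
  by near=> t; split; near: t.
have hI t : `]t0 - d, t0 + d[%classic t -> [/\ A t,
    (forall y, is_derive (t : R) 1 (F ^~ y) (dF t y)) & continuous (F t)].
  rewrite /= in_itv/= => /andP[t1 t2]; apply: hd.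
  by rewrite /ball/= ltr_norml; apply/andP; split; lra.
have It0 : `]t0 - d, t0 + d[%classic t0.
  by rewrite /= in_itv/= ltrBlDr ltrDl d0.
have dfy t y : `]t0 - d, t0 + d[%classic t ->
    is_derive t 1 (fun t => F t y * phi y) (dF t y * phi y).
  move=> /hI[_ /(_ y) h _].
  apply: (is_derive_eq (is_derive_mulf h (is_derive_cst (phi y) t 1))).
  by rewrite mulr0 addr0.
have p1E t y : `]t0 - d, t0 + d[%classic t ->
    partial1of2 (fun t y => F t y * phi y) t y = dF t y * phi y.
  by move=> /(dfy _ y) h; rewrite partial1of2E derive_val.
have intf t : `]t0 - d, t0 + d[%classic t ->
    mu.-integrable setT (EFin \o (fun y => F t y * phi y)).
  by move=> /hI[_ _ h]; exact: integrable_mul_cube_support.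
have derf t y : `]t0 - d, t0 + d[%classic t -> setT y ->
    derivable ((fun t y => F t y * phi y) ^~ y) t 1.
  by move=> /(dfy _ y)[].
pose G y := c * `|phi y|.
have G0 y : 0 <= G y by rewrite mulr_ge0// addr_ge0.
have intG : mu.-integrable setT (EFin \o G).
  apply: integrable_cube_support => [y|y yM].
    exact: (continuousM (@cst_continuous _ _ _ y) (@norm_phi_continuous y)).
  by rewrite /G phi_support// normr0 mulr0.
have Gub t y : `]t0 - d, t0 + d[%classic t -> setT y ->
    `|partial1of2 (fun t y => F t y * phi y) t y| <= G y.
  move=> It _; rewrite p1E// normrM /G.
  have [yM|yM] := pselect (cube M y); last by rewrite phi_support// normr0 !mulr0.
  have [At _ _] := hI t It.
  by rewrite ler_wpM2r//; exact: (AB (t, c) (conj At Bc)).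
split.
  exact: (derivable_under_integral measurableT It0 intf derf G0 intG Gub).
have := differentiation_under_integral measurableT It0 intf derf G0 intG Gub.
by rewrite derive1E => ->; apply: eq_Rintegral => y _; rewrite p1E.
Unshelve. all: by end_near. Qed.

End parametric_integrals.

(** * Heat potentials of compactly supported functions *)

Section heat_potential.
Context {R : realType} {N : nat}.
Variables (m : nat) (M : R) (phi : 'rV[R]_N -> R).
Hypothesis M0 : 0 <= M.
Hypothesis phi_continuous : continuous phi.
Hypothesis phi_support : forall y, ~ cube M y -> phi y = 0.
Local Notation mu := (lebesgue_rV R N).
Implicit Types (t : R) (x y : 'rV[R]_N) (i : 'I_N).

(** The integral runs over the whole space: in the uses below [phi] vanishes off
Omega. *)
Definition potential t x : R := \int[mu]_y (hkernel m t x y * phi y).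

Definition dpotential i k t x : R := \int[mu]_y (dkernel m i k t x y * phi y).

Lemma continuous_hkernel t x : 0 < t -> continuous (hkernel m t x).
Proof.
move=> t0 y; apply: (@cvg_hkernel R N m _ _ (nbhs_filter y) (cst t) (cst x) id) => //.
- exact: cvg_cst.
- exact: cvg_cst.
Qed.

Lemma continuous_dkernel i k t x : 0 < t -> continuous (dkernel m i k t x).
Proof.
move=> t0 y; apply: (@cvg_dkernel R N m _ _ (nbhs_filter y) (cst t) (cst x) id) => //.
- exact: cvg_cst.
- exact: cvg_cst.
Qed.

Lemma potential_continuous t x : 0 < t ->
  potential p.1 p.2 @[p --> (t, x)] --> potential t x.
Proof.
move=> t0; apply: (@continuous_integral_param R N M M0 phi phi_continuous
  phi_support _ (fun p => hkernel m p.1 p.2) (t, x)) => [|y].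
  exists ([set s | 0 < s], setT); last by move=> p [/= p0 _]; exact: continuous_hkernel.
  by split; [exact: lt_nbhsr|exact: filterT].
apply: (@cvg_hkernel R N m _ _ (nbhs_filter ((t, x), y)) (fun q => q.1.1)
  (fun q => q.1.2) snd) => //.
- exact: (cvg_comp _ _ cvg_fst cvg_fst).
- exact: (cvg_comp _ _ cvg_fst cvg_snd).
- exact: cvg_snd.
Qed.

Lemma is_derive_dpotential i k t x (r : R) : (k < 2)%N -> 0 < t ->
  is_derive r 1 (fun r : R => dpotential i k t (x + r *: delta_mx ord0 i))
    (dpotential i k.+1 t (x + r *: delta_mx ord0 i)).
Proof.
move=> k2 t0; apply: (@is_derive_integral_param R N M M0 phi phi_continuous
  phi_support (fun r => dkernel m i k t (x + r *: delta_mx ord0 i))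
  (fun r => dkernel m i k.+1 t (x + r *: delta_mx ord0 i)) r).
- by apply: (@nearW _ (nbhs r)) => s y; exact: is_derive_dkernel.
- by apply: (@nearW _ (nbhs r)) => s; exact: continuous_dkernel.
move=> y; apply: (@cvg_dkernel R N m _ _ (nbhs_filter (r, y)) (cst t)
  (fun q => x + q.1 *: delta_mx ord0 i) snd) => //.
- exact: cvg_cst.
- apply: (@cvgD _ _ _ _ (nbhs_filter (r, y))); first exact: cvg_cst.
  apply: (@cvgZ _ _ _ _ (nbhs_filter (r, y))); last exact: cvg_cst.
  exact: cvg_fst.
- exact: cvg_snd.
Qed.

Lemma potential_dpotential i t x : potential t x = dpotential i 0 t x.
Proof. by apply: eq_Rintegral => y _; rewrite (hkernel_dkernel m i). Qed.

(** The heat equation: the right-hand side is the Laplacian, by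
[is_derive_dpotential]. *)
Lemma is_derive_potential_time t x : 0 < t ->
  is_derive t 1 (potential ^~ x) (\sum_(i < N) dpotential i 2 t x).
Proof.
move=> t0; rewrite -(Rintegral_sum_mul M0 phi_continuous phi_support); last first.
  by move=> i; exact: continuous_dkernel.
have near0 : \forall s \near t, 0 < s by exact: lt_nbhsr.
apply: (@is_derive_integral_param R N M M0 phi phi_continuous phi_support
  (fun t => hkernel m t x) (fun t y => \sum_(i < N) dkernel m i 2 t x y) t).
- by apply: (@filterS _ (nbhs t) _ _ _ _ near0) => s s0 y; exact: is_derive_hkernel_time.
- by apply: (@filterS _ (nbhs t) _ _ _ _ near0) => s s0; exact: continuous_hkernel.
move=> y; apply: cvg_big => [|i _]; first exact: add_continuous.
apply: (@cvg_dkernel R N m _ _ (nbhs_filter (t, y)) fst (cst x) snd) => //.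
- exact: cvg_fst.
- exact: cvg_cst.
- exact: cvg_snd.
Qed.

Hypothesis phi_ge0 : forall y, 0 <= phi y.
Hypothesis phi_out : forall y, ~ Omega m y -> phi y = 0.

Lemma hkernel_phi_ge0 t x y : 0 < t -> Omega m x -> 0 <= hkernel m t x y * phi y.
Proof.
move=> t0 xO; have [yO|yO] := pselect (Omega m y); last by rewrite phi_out// mulr0.
by rewrite mulr_ge0// hkernel_ge0.
Qed.

Lemma potential_ge0 t x : 0 < t -> Omega m x -> 0 <= potential t x.
Proof. by move=> t0 xO; apply: Rintegral_ge0 => y _; exact: hkernel_phi_ge0. Qed.

Lemma EFin_potential t x : 0 < t ->
  (potential t x)%:E = (\int[mu]_y (hkernel m t x y * phi y)%:E)%E.
Proof.
move=> t0; rewrite /potential /Rintegral fineK//.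
apply: integrable_fin_num => //.
apply: (integrable_mul_cube_support M0 phi_continuous phi_support).
exact: continuous_hkernel.
Qed.

End heat_potential.

(** * The heat kernel as an approximate identity *)

Section gaussian_mass.
Context {R : realType}.
Local Notation leb := (@lebesgue_measure R).
Implicit Types (t x w z r c : R).

(** Doubling the time costs a factor sqrt 2 and leaves exp (- w^2 / (8 t)), which
is at most 8 t / w^2.  The right-hand side has a known integral, so the mass of
the tail is of order t / r^2. *)
Lemma gaussian_tail t r w : 0 < t -> 0 < r -> r <= `|w| ->
  gaussian t w <= 16 * t / r ^+ 2 * gaussian (2 * t) w.
Proof.
move=> t0 r0 rw; have p0 := pi_gt0 R.
have rw2 : r ^+ 2 <= w ^+ 2 by rewrite -(real_normK (num_real w)) lerXn2r ?nnegrE ?(ltW r0).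
have r20 : 0 < r ^+ 2 by rewrite exprn_gt0.
have w20 : 0 < w ^+ 2 by exact: lt_le_trans rw2.
pose q := w ^+ 2 / (8 * t).
have q0 : 0 < q by rewrite divr_gt0// mulr_gt0.
have -> : gaussian t w = expR (ln 2 / 2) * expR (- q) * gaussian (2 * t) w.
  rewrite /gaussian -!expRD; congr expR.
  have -> : 4 * pi * (2 * t) = 2 * (4 * pi * t) by ring.
  rewrite (@lnM _ 2) ?posrE ?mulr_gt0// /q.
  by move: (ln 2) (ln _) => a b; field; rewrite gt_eqF.
rewrite ler_wpM2r//; first by rewrite ltW// gaussian_gt0.
have h1 : expR (ln 2 / 2) <= 2 :> R.
  rewrite -[leRHS](@lnK R) ?posrE// ler_expR.
  by have := @ln_ge0 R 2; rewrite ler1n => /(_ isT); lra.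
have h2 : expR (- q) <= 8 * t / r ^+ 2.
  rewrite expRN (@le_trans _ _ q^-1)//.
    rewrite lef_pV2 ?posrE ?expR_gt0//.
    by apply: le_trans (expR_ge1Dx q); rewrite lerDr.
  by rewrite /q invf_div ler_pM2l ?mulr_gt0// lef_pV2 ?posrE.
apply: (@le_trans _ _ (2 * (8 * t / r ^+ 2))).
  by rewrite ler_pM ?expR_ge0.
by rewrite mulrA mulrA -natrM.
Qed.

Lemma gaussian_shift t x z : 0 < t ->
  gaussian t (z - x) = normal_pdf x (Num.sqrt (2 * t)) z.
Proof.
move=> t0; have s0 : Num.sqrt (2 * t) != 0.
  by rewrite gt_eqF// sqrtr_gt0 mulr_gt0.
rewrite gaussian_normal_pdf// !normal_pdfE// /normal_fun.
by rewrite subr0.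
Qed.

Lemma integrable_gaussian_shift t x : 0 < t ->
  leb.-integrable setT (fun z => (gaussian t (z - x))%:E).
Proof.
move=> t0; under eq_fun do rewrite gaussian_shift//.
exact: integrable_normal_pdf.
Qed.

Lemma Rintegral_gaussian_shift t x : 0 < t ->
  \int[leb]_z gaussian t (z - x) = 1.
Proof.
move=> t0; under eq_Rintegral do rewrite gaussian_shift//.
by rewrite /Rintegral integral_normal_pdf.
Qed.

(** The mass lost by the truncation, and that lost by reflection, are both tails of
Gaussians: if z is within r of x and r <= x, then x + z >= r. *)
Lemma kernel1_mass (b : bool) t r x : 0 < t -> 0 < r -> (b -> r <= x) ->
  ((1 - 2 * (16 * t / r ^+ 2))%:E <=
   \int[leb]_z (kernel1 0 b t x z * \1_(ball x r) z)%:E)%E.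
Proof.
move=> t0 r0 rx; set c := 16 * t / r ^+ 2.
have c0 : 0 <= c by rewrite divr_ge0 ?sqr_ge0// mulr_ge0// ltW.
have t20 : 0 < 2 * t by rewrite mulr_gt0.
have g0 s w : 0 <= gaussian s w :> R by rewrite ltW// gaussian_gt0.
(* A lower bound of the truncated kernel on the whole line, whose integral is
   1 - 2 c. *)
pose h z := gaussian t (z - x) - c * gaussian (2 * t) (z - x) - c * gaussian (2 * t) (z - (- x)).
have sym s z : gaussian s (x - z) = gaussian s (z - x) :> R.
  by rewrite -gaussianN opprB.
have i1 := integrable_gaussian_shift x t0.
have i2 := integrableZl measurableT c (integrable_gaussian_shift x t20).
have i3 := integrableZl measurableT c (integrable_gaussian_shift (- x) t20).
have i12 := integrableB measurableT i1 i2.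
have ih := integrableB measurableT i12 i3.
have -> : (1 - 2 * c)%:E = (\int[leb]_z (h z)%:E)%E.
  rewrite -[RHS]fineK; last exact: integrable_fin_num ih.
  rewrite -/(Rintegral _ _ _) /h RintegralB// RintegralB//.
  rewrite !RintegralZl//; [|exact: integrable_gaussian_shift..].
  by rewrite !Rintegral_gaussian_shift//; congr (_%:E); ring.
have kE z : kernel1 0 b t x z = gaussian t (z - x) - b%:R * gaussian t (z - (- x)).
  by rewrite /kernel1 /dgaussian/= !mul1r sym opprK [z + x]addrC.
have k0 z : 0 <= kernel1 0 b t x z * \1_(ball x r) z.
  rewrite indicE; have [|_] := boolP (z \in _); last by rewrite mulr0.
  rewrite inE /ball/= mulr1 => xz; apply: kernel1_ge0 => // /rx rx'; first lra.
  by move: xz; rewrite ltr_norml => /andP[_ ?]; lra.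
have kg z : kernel1 0 b t x z * \1_(ball x r) z <= gaussian t (z - x).
  rewrite indicE kE; have [_|_] := boolP (z \in _); last by rewrite mulr0.
  by rewrite mulr1 lerBlDr lerDl mulr_ge0.
have ik : leb.-integrable setT (EFin \o (fun z => kernel1 0 b t x z * \1_(ball x r) z)).
  apply: (le_integrable measurableT _ _ (integrable_gaussian_shift x t0)).
    apply/measurable_EFinP/measurable_funM.
      apply: continuous_measurable_fun => z.
      by apply: cvg_kernel1 => //; exact: cvg_cst.
    by apply: measurable_indic; exact: measurable_ball.
  by move=> z _ /=; rewrite !ger0_norm// lee_fin.
apply: le_integral => // z _; rewrite lee_fin /h.
rewrite indicE; have [|] := boolP (z \in _).
  rewrite inE /ball/= mulr1 kE => xz; case: b {k0 kg ik kE} rx => /= rx; last first.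
    by rewrite mul0r subr0 -addrA gerDl -opprD oppr_le0 addr_ge0// mulr_ge0.
  rewrite mul1r; apply: lerB; first by rewrite lerBlDr lerDl mulr_ge0.
  apply: gaussian_tail => //; have := rx isT; move: xz; rewrite ltr_norml => /andP[? ?] ?.
  by rewrite ger0_norm; lra.
move=> /negP; rewrite inE /ball/= mulr0 => /negP; rewrite -leNgt => xz.
rewrite subr_le0 (@le_trans _ _ 0)//; last by rewrite mulr_ge0.
by rewrite subr_le0 gaussian_tail// distrC.
Qed.

End gaussian_mass.

Section approximate_identity.
Context {R : realType} {N : nat}.
Variables (m : nat) (M : R) (phi : 'rV[R]_N -> R).
Hypothesis M0 : 0 <= M.
Hypothesis phi_continuous : continuous phi.
Hypothesis phi_support : forall y, ~ cube M y -> phi y = 0.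
Hypothesis phi_ge0 : forall y, 0 <= phi y.
Hypothesis phi_out : forall y, ~ Omega m y -> phi y = 0.
Local Notation mu := (lebesgue_rV R N).
Implicit Types (t : R) (x y : 'rV[R]_N) (i : 'I_N).

Let phi_bounded : exists2 B, 0 <= B & forall y, phi y <= B.
Proof.
have c0 : (cube M : set 'rV[R]_N) !=set0.
  by exists (0 : 'rV[R]_N) => i; rewrite mxE normr0.
have cp : {within cube M, continuous phi} by exact: continuous_subspaceT.
have [c _ hc] := compact_EVT_max c0 (@compact_cube R N M) cp.
exists (phi c) => // y; have [yM|yM] := pselect (cube M y).
  by apply: hc; rewrite inE.
by rewrite phi_support.
Qed.

(** Heine's theorem; outside the support the inequality is trivial. *)
Let phi_uniform e : 0 < e -> exists2 r, 0 < r &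
  forall x y, ball x r y -> phi x <= phi y + e.
Proof.
move=> e0; have /compact_near_coveringP cov := @compact_cube R N M.
have : \forall r \near 0^'+, cube M `<=`
    (fun x => forall y, ball x r y -> phi x <= phi y + e).
  apply: (cov R (0^'+) (fun r x => forall y, ball x r y -> phi x <= phi y + e)).
  move=> x xM; have e20 : 0 < e / 2 by rewrite divr_gt0.
  have /cvgrPdist_lt /(_ _ e20) /nbhs_ballP[d /= d0 hd] := @phi_continuous x.
  have d20 : 0 < d / 2 by rewrite divr_gt0.
  exists (ball x (d / 2), [set r | r < d / 2]).
    split; first exact: nbhsx_ballx.
    by exact: nbhs_right_lt.
  move=> [x' r] /= [xx' rd] y x'y.
  have /hd h1 : ball x d x' by apply: le_ball xx'; lra.
  have /hd h2 : ball x d y.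
    rewrite (splitr d); apply: ball_triangle xx' _.
    by apply: le_ball x'y; exact: ltW.
  move: h1 h2; rewrite /= !ltr_norml => /andP[? ?] /andP[? ?]; lra.
move=> h; have : \forall r \near 0^'+, 0 < r /\ cube M `<=`
    (fun x => forall y, ball x r y -> phi x <= phi y + e).
  by apply: filterS2 h (nbhs_right_gt 0) => r h1 h2.
move=> /filter_ex[r [r0 hr]]; exists r => // x y xy.
have [xM|xM] := pselect (cube M x); first exact: hr.
by rewrite phi_support// addr_ge0// ltW.
Qed.

Let bernoulli n (a : R) : 0 <= a <= 1 -> 1 - n%:R * a <= (1 - a) ^+ n.
Proof.
move=> /andP[a0 a1]; elim: n => [|n IH]; first by rewrite mul0r subr0 expr0.
rewrite exprS; have h : 0 <= 1 - a by rewrite subr_ge0.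
apply: le_trans (ler_wpM2l h IH); rewrite -natr1.
have : 0 <= n%:R * a * a :> R by rewrite !mulr_ge0.
by move: (n%:R) => k; nra.
Qed.

(** Where phi x > e / 2, the ball of radius r around x lies in Omega, since phi does
not vanish there, so x is at distance at least r from the boundary.  The kernel
restricted to that ball is a product of one-dimensional truncated kernels, each of
mass at least 1 - c, and phi >= phi x - e / 2 on the ball.  Bernoulli's inequality
turns (1 - c)^N into a linear error. *)
Lemma approximate_identity e : 0 < e -> exists2 t0, 0 < t0 &
  forall t x, 0 < t < t0 -> Omega m x -> phi x <= potential m phi t x + e.
Proof.
move=> e0; have [B B0 hB] := phi_bounded.
have e20 : 0 < e / 2 by rewrite divr_gt0.
have [r r0 hr] := phi_uniform e20.
(* An upper bound for the mass c lost in each coordinate. *)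
pose a := Num.min 1 (e / 2 / (N%:R * B + 1)).
have NB : 0 < N%:R * B + 1 by rewrite ltr_wpDl// mulr_ge0.
have a0 : 0 < a by rewrite lt_min ltr01 divr_gt0.
exists (a * r ^+ 2 / 32); first by rewrite !mulr_gt0// ?invr_gt0 exprn_gt0.
move=> t x /andP[t0 ta] xO.
pose c := 2 * (16 * t / r ^+ 2).
have r20 : 0 < r ^+ 2 by rewrite exprn_gt0.
have c0 : 0 <= c by rewrite !mulr_ge0 ?invr_ge0// ltW.
have ca : c <= a.
  rewrite /c mulrA ler_pdivrMr//; move: ta; rewrite ltr_pdivlMr//; lra.
have c1 : c <= 1 by rewrite (le_trans ca)// ge_min lexx.
have cB : N%:R * B * c <= e / 2.
  apply: (@le_trans _ _ ((N%:R * B + 1) * c)).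
    by rewrite ler_wpM2r// lerDl.
  by rewrite mulrC -ler_pdivlMr// (le_trans ca)// ge_min lexx orbT.
have p0 := potential_ge0 phi_ge0 phi_out t0 xO.
have [xe|xe] := leP (phi x) (e / 2); first by rewrite (le_trans xe)//; lra.
have ballO y : ball x r y -> Omega m y.
  move=> /hr h; apply: contrapT => yO; move: h; rewrite (phi_out yO) add0r.
  by rewrite leNgt xe.
have xr i : (i < m)%N -> r <= x ord0 i.
  move=> im; rewrite leNgt; apply/negP => xir.
  have /(_ i im) : Omega m (x - x ord0 i *: delta_mx ord0 i).
    apply: ballO; split => // k j; rewrite (ord1 k) !mxE eqxx /=.
    have [->|ji] := eqVneq j i; rewrite /= ?mulr1 ?mulr0 ?subrr ?subr0; last exact: ballxx.
    by rewrite /ball/= subr0 gtr0_norm// xO.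
  by rewrite !mxE !eqxx mulr1 subrr ltxx.
pose F i z := kernel1 0 (i < m)%N t (x ord0 i) z * \1_(ball (x ord0 i) r) z.
have F0 i z : 0 <= F i z.
  rewrite /F indicE; have [|_] := boolP (z \in _); last by rewrite mulr0.
  rewrite inE /ball/= mulr1 ltr_norml => /andP[_ xz].
  by apply: kernel1_ge0 => // /xr ?; lra.
have mF i : measurable_fun setT (F i).
  apply: measurable_funM.
    apply: continuous_measurable_fun => z.
    by apply: cvg_kernel1 => //; exact: cvg_cst.
  by apply: measurable_indic; exact: measurable_ball.
have prodF0 y : 0 <= \prod_(i < N) F i (y ord0 i) by apply: prodr_ge0 => i _.
pose d := phi x - e / 2.
have d0 : 0 < d by rewrite subr_gt0.
have mprodF : measurable_fun setT (fun y : 'rV[R]_N => \prod_(i < N) F i (y ord0 i)).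
  by apply: measurable_prod => i _; exact: measurableT_comp (mF i) (measurable_coord i).
have key : (d%:E * ((1 - c) ^+ N)%:E <= (potential m phi t x)%:E)%E.
  rewrite (EFin_potential m M0 phi_continuous phi_support)//.
  apply: (@le_trans _ _ (\int[mu]_y (d%:E * (\prod_(i < N) F i (y ord0 i))%:E))%E).
    rewrite ge0_integralZl//; last 3 first.
    - exact/measurable_EFinP.
    - by move=> y _; rewrite lee_fin.
    - by rewrite lee_fin ltW.
    rewrite lee_pmul2l// integral_rV_prod//.
    rewrite -[((1 - c) ^+ N)%:E](_ : (\prod_(i < N) (1 - c)%:E)%E = _); last first.
      by rewrite prodEFin big_const_ord iter_mulr_1.
    pose P (u v : \bar R) := (0 <= u)%E /\ (u <= v)%E.
    suff [] : P (\prod_(i < N) (1 - c)%:E)%E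
      (\prod_(i < N) \int[@lebesgue_measure R]_z (F i z)%:E)%E by [].
    apply: big_ind2 => [|u1 u2 v1 v2 [u10 u12] [v10 v12]|i _].
    - by split => //; rewrite lee_fin.
    - by split; [exact: mule_ge0|exact: lee_pmul].
    - split; first by rewrite lee_fin subr_ge0.
      by apply: kernel1_mass => //; exact: xr.
  apply: ge0_le_integral => //.
  - by move=> y _; rewrite -EFinM lee_fin mulr_ge0// ltW.
  - by apply/measurable_EFinP; apply: measurable_funM.
  - apply/measurable_EFinP; apply: measurable_funM.
      by apply: continuous_measurable_rV; exact: continuous_hkernel.
    exact: continuous_measurable_rV.
  move=> y _; rewrite -EFinM lee_fin.
  have [xy|xy] := pselect (ball x r y).
    rewrite mulrC; have -> : \prod_(i < N) F i (y ord0 i) = hkernel m t x y.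
      apply: eq_bigr => i _; rewrite /F indicE mem_set ?mulr1//.
      by case: xy => _ /(_ ord0 i).
    rewrite ler_wpM2l//; first by rewrite hkernel_ge0//; exact: ballO.
    by rewrite /d lerBlDr; exact: hr.
  suff -> : \prod_(i < N) F i (y ord0 i) = 0.
    by rewrite mulr0; exact: hkernel_phi_ge0.
  have [i xyi] : exists i, ~ ball (x ord0 i) r (y ord0 i).
    apply/existsNP => h; apply: xy; split => // k j; rewrite (ord1 k); exact: h.
  by rewrite (bigD1 i)//= /F indicE memNset// mulr0 mul0r.
move: key; rewrite -EFinM lee_fin => key.
have := bernoulli N (a := c); rewrite c0 c1 => /(_ isT) hb.
have : d * (1 - N%:R * c) <= potential m phi t x.
  by apply: le_trans key; rewrite ler_pM2l.
have : d * (N%:R * c) <= N%:R * B * c.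
  have dB : d <= B by rewrite /d lerBlDr (le_trans (hB x))// lerDl ltW.
  have Nc : 0 <= N%:R * c by rewrite mulr_ge0.
  by rewrite (_ : N%:R * B * c = B * (N%:R * c)); [exact: ler_wpM2r|ring].
rewrite mulrBr mulr1 /d; lra.
Qed.

End approximate_identity.

(** * Integrability of the heat kernel against the weight *)

Section weight.
Context {R : realType} {N : nat}.
Variables (m : nat) (gamma : R).
Hypothesis mN : (1 <= m <= N)%N.
Hypothesis gammaN : 0 < gamma < N%:R.
Local Notation mu := (lebesgue_rV R N).
Local Notation Om := (@Omega R N m).
Implicit Types (t : R) (x y : 'rV[R]_N) (i : 'I_N).

(** The inverse of the weight [rho], as a product so that it is measurable on the
whole space. *)
Definition invrho y : R :=
  (\prod_(i < N | (i < m)%N) y ord0 i) * enorm y `^ (- (gamma + 2 * m%:R)).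

Lemma enorm_gt0 y : Om y -> 0 < enorm y.
Proof.
case/andP: mN => m0 mN' yO; have N0 : (0 < N)%N by exact: leq_trans mN'.
apply: lt_le_trans (coord_le_enorm y (Ordinal N0)).
by rewrite normr_gt0 gt_eqF// yO.
Qed.

Lemma prod_coord_gt0 y : Om y -> 0 < \prod_(i < N | (i < m)%N) y ord0 i.
Proof. by move=> yO; apply: prodr_gt0 => i; exact: yO. Qed.

Lemma invrho_ge0 y : Om y -> 0 <= invrho y.
Proof. by move=> yO; rewrite mulr_ge0 ?powR_ge0// ltW// prod_coord_gt0. Qed.

Lemma rho_invrho y : Om y -> rho m gamma y * invrho y = 1.
Proof.
move=> yO; rewrite /rho /invrho powRN.
have := prod_coord_gt0 yO; set p := \prod_(i < N | _) _ => p0.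
have := powR_gt0 (gamma + 2 * m%:R) (enorm_gt0 yO); set q := _ `^ _ => q0.
by field; rewrite !gt_eqF.
Qed.

Lemma measurable_enorm : measurable_fun setT (@enorm R N).
Proof.
apply: measurableT_comp.
  exact: continuous_measurable_fun (@sqrt_continuous R).
apply: measurable_sum => i; apply: measurable_funX.
exact: measurable_coord.
Qed.

Lemma measurable_invrho : measurable_fun setT invrho.
Proof.
apply: measurable_funM.
  under eq_fun do rewrite big_mkcond.
  apply: measurable_prod => i _; case: (i < m)%N; last exact: measurable_cst.
  exact: measurable_coord.
exact: measurableT_comp (measurable_powR _) measurable_enorm.
Qed.

Lemma measurable_Omega : measurable Om.
Proof. exact: open_measurable_rV (@open_Omega R N m). Qed.

Lemma prod_coord_le_enorm y : Om y ->
  \prod_(i < N | (i < m)%N) y ord0 i <= enorm y ^+ m.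
Proof.
case/andP: mN => m0 mN' yO.
have -> : enorm y ^+ m = \prod_(i < N | (i < m)%N) enorm y.
  by rewrite -(big_ord_widen _ (fun=> enorm y) mN') prodr_const card_ord.
apply: ler_prod => i im; rewrite ltW ?yO//=.
exact: le_trans (ler_norm _) (coord_le_enorm _ _).
Qed.

(** In each of the first m coordinates the reflected kernel is the Gaussian times
1 - exp (- x_i y_i / t) <= x_i y_i / t.  The factors y_i so gained, together with
those of 1 / rho, give at most |y|^(2 m), which compensates the same power in
rho. *)
Lemma hkernel_invrho_le t x y : 0 < t -> Om x -> Om y ->
  hkernel m t x y * invrho y <= (\prod_(i < N | (i < m)%N) (x ord0 i / t)) *
    (\prod_(i < N) gaussian t (y ord0 i - x ord0 i) * enorm y `^ (- gamma)).
Proof.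
move=> t0 xO yO; have e0 := enorm_gt0 yO; have p0 := prod_coord_gt0 yO.
set P := \prod_(i < N | _) y _ _ in p0.
set A := \prod_(i < N | _) _; set G := \prod_(i < N) _.
have A0 : 0 <= A by apply: prodr_ge0 => i im; rewrite divr_ge0// ltW// xO.
have G0 : 0 <= G by apply: prodr_ge0 => i _; rewrite ltW// gaussian_gt0.
have hK : hkernel m t x y <= G * (A * P).
  have -> : G * (A * P) = \prod_(i < N) (gaussian t (y ord0 i - x ord0 i) *
      (if (i < m)%N then x ord0 i / t * y ord0 i else 1)).
    by rewrite big_split/= -big_mkcond/= big_split.
  apply: ler_prod => i _; apply/andP; split.
    by apply: kernel1_ge0 => // im; rewrite ltW//; [exact: xO|exact: yO].
  rewrite /kernel1 /dgaussian/= !mul1r -[gaussian t (x _ _ - _)]gaussianN opprB.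
  case: ifPn => im; last by rewrite mul0r subr0 mulr1.
  have xi := xO i im; have yi := yO i im.
  move: (x ord0 i) (y ord0 i) xi yi => a b a0 b0; rewrite mul1r.
  have -> : gaussian t (a + b) = gaussian t (b - a) * expR (- (a / t * b)).
    by rewrite /gaussian -expRD; congr expR; field; rewrite gt_eqF.
  rewrite -[X in X - _]mulr1 -mulrBr ler_pM2l ?gaussian_gt0//.
  by have := expR_ge1Dx (- (a / t * b)); lra.
apply: (@le_trans _ _ (G * (A * P) * invrho y)).
  by rewrite ler_wpM2r// invrho_ge0.
rewrite /invrho -/P; set q := _ `^ (- (gamma + _)).
rewrite (_ : G * (A * P) * (P * q) = A * (G * (P ^+ 2 * q))); last by ring.
rewrite ler_wpM2l// ler_wpM2l//.
apply: (@le_trans _ _ (enorm y ^+ m ^+ 2 * q)).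
  rewrite ler_wpM2r ?powR_ge0// lerXn2r ?nnegrE ?prod_coord_le_enorm//.
    exact: ltW.
  by rewrite exprn_ge0// ltW.
rewrite -exprM -powR_mulrn ?(ltW e0)// /q -powRD; last first.
  by apply/implyP => _; rewrite gt_eqF.
by rewrite natrM (_ : m%:R * 2 - (gamma + 2 * m%:R) = - gamma)//; ring.
Qed.

(* The sum over k of these functions dominates |y|^(-gamma) on the unit ball, and
   their integrals form a geometric series of ratio 2^(gamma - N) < 1. *)
Let dyadic k y : R := 2 `^ (gamma * k.+1%:R) * \1_(cube (2^-1 ^+ k)) y.

Let dyadic_ge0 k y : 0 <= dyadic k y.
Proof. by rewrite mulr_ge0 ?powR_ge0. Qed.

Let dyadic_measurable k : measurable_fun setT (dyadic k).
Proof.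
apply: measurable_funM => //; apply: measurable_indic; exact: measurable_cube.
Qed.

Let dyadic_integral k : (\int[mu]_y (dyadic k y)%:E =
  (2 `^ (gamma + N%:R) * (2 `^ (gamma - N%:R)) ^+ k)%:E)%E.
Proof.
under eq_integral do rewrite EFinM.
rewrite ge0_integralZl//; last first.
  by apply/measurable_EFinP; apply: measurable_indic; exact: measurable_cube.
rewrite integral_indic//; last exact: measurable_cube.
rewrite setIT.
rewrite [X in (_ * X)%E](_ : _ = ((2 * 2^-1 ^+ k) ^+ N)%:E); last first.
  by apply: lebesgue_rV_cube; rewrite exprn_ge0.
rewrite -EFinM; congr (_%:E).
have -> : (2 * 2^-1 ^+ k) ^+ N = 2 `^ (N%:R - N%:R * k%:R) :> R.
  rewrite powRB ?pnatr_eq0 ?implybT// -natrM !powR_mulrn// exprMn.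
  by congr (_ * _); rewrite -exprM exprVn mulnC.
rewrite -!powR_mulrn ?powR_ge0// -powRrM -!powRD ?pnatr_eq0 ?implybT//.
by congr (_ `^ _); rewrite -natr1; ring.
Qed.

Let dyadic_sum : (\int[mu]_y (\sum_(0 <= k <oo) (dyadic k y)%:E) < +oo)%E.
Proof.
rewrite integral_nneseries//; last 2 first.
- by move=> k; exact/measurable_EFinP.
- by move=> k y _; rewrite lee_fin.
under eq_eseriesr do rewrite dyadic_integral.
pose q : R := 2 `^ (gamma - N%:R); pose a : R := 2 `^ (gamma + N%:R).
have q0 : 0 < q by rewrite powR_gt0.
have q1 : q < 1.
  have l2 : 0 < ln 2 :> R by apply: ln_gt0; rewrite ltr1n.
  rewrite /q /powR pnatr_eq0/= -[ltRHS]expR0 ltr_expR pmulr_llt0// subr_lt0.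
  by case/andP: gammaN.
apply: (@le_lt_trans _ _ (a * (1 - q)^-1)%:E); last exact: ltry.
apply: lime_le.
  by apply: is_cvg_nneseries => k _ _; rewrite lee_fin mulr_ge0 ?exprn_ge0 ?powR_ge0.
apply: nearW => n; rewrite sumEFin lee_fin.
by apply: geometric_le_lim => //; rewrite ?powR_ge0// gtr0_norm.
Qed.

(* Only the term for which 2^-(k+1) <= |y| < 2^-k is used. *)
Let dyadic_le y : 0 < enorm y -> enorm y < 1 ->
  ((enorm y `^ (- gamma))%:E <= \sum_(0 <= k <oo) (dyadic k y)%:E)%E.
Proof.
move=> y0 y1; have g0 : 0 < gamma by case/andP: gammaN.
have h0 : 0 < 2^-1 :> R by rewrite invr_gt0.
have ex : exists k, 2^-1 ^+ k.+1 <= enorm y.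
  have h1 : `|2^-1 : R| < 1 by rewrite gtr0_norm// invf_lt1// ltr1n.
  have /cvgrPdist_lt /(_ _ y0)[k _ /(_ k.+1 (leqnSn k))] := cvg_geometric 1 h1.
  rewrite /= mul1r sub0r normrN ger0_norm ?exprn_ge0 ?(ltW h0)// => hk.
  by exists k; exact: ltW.
(* By minimality 2^-k is larger than |y|, the case k = 0 being |y| < 1. *)
case: (ex_minnP ex) => k ky kmin.
have yk : cube (2^-1 ^+ k) y.
  apply: cube_le (@cube_enorm _ _ y).
  case: k {ky} kmin => [|k] kmin; first by rewrite expr0 ltW.
  by rewrite leNgt; apply/negP => /ltW /kmin; rewrite ltnn.
apply: (@le_trans _ _ (\sum_(0 <= j < k.+1) (dyadic j y)%:E)%E); last first.
  by apply: nneseries_lim_ge => j _ _; rewrite lee_fin.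
rewrite big_nat_recr//= (@le_trans _ _ (dyadic k y)%:E)//; last first.
  by rewrite leeDr// sume_ge0// => j _; rewrite lee_fin.
rewrite lee_fin /dyadic indicE mem_set// mulr1 mulrC powRrM powR_mulrn//.
rewrite -[- gamma]mulN1r powRrM powR_inv1 ?(ltW y0)//.
apply: ge0_ler_powR; rewrite ?nnegrE ?(ltW g0) ?exprn_ge0 ?invr_ge0 ?(ltW y0)//.
by rewrite -[leRHS]invrK lef_pV2 ?posrE ?invr_gt0 ?exprn_gt0// -exprVn.
Qed.

(** For |y| >= 1 the Gaussian factor is integrable and |y|^(-gamma) <= 1; for
|y| < 1 the Gaussian factor is bounded and the dyadic sum dominates. *)
Lemma hkernel_invrho_integrable t x : 0 < t -> Om x ->
  (\int[mu]_(y in Om) (hkernel m t x y * invrho y)%:E < +oo)%E.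
Proof.
move=> t0 xO; have mO := measurable_Omega.
pose A : R := \prod_(i < N | (i < m)%N) (x ord0 i / t).
have A0 : 0 <= A by apply: prodr_ge0 => i im; rewrite divr_ge0// ltW// xO.
pose G y := \prod_(i < N) gaussian t (y ord0 i - x ord0 i).
have G0 y : 0 <= G y by apply: prodr_ge0 => i _; rewrite ltW// gaussian_gt0.
have mg i : measurable_fun [set: R] (fun z => gaussian t (z - x ord0 i)).
  by under eq_fun do rewrite gaussian_shift//; exact: measurable_normal_pdf.
have mG : measurable_fun setT G.
  by apply: measurable_prod => i _; exact: measurableT_comp (mg i) (measurable_coord i).
pose B : R := gaussian t 0 ^+ N.
have GB y : G y <= B.
  have -> : B = \prod_(i < N) gaussian t 0 by rewrite prodr_const card_ord.
  apply: ler_prod => i _; rewrite ltW ?gaussian_gt0//= /gaussian ler_expR.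
  by rewrite lerD2l lerN2 expr0n mul0r divr_ge0 ?sqr_ge0// mulr_ge0// ltW.
have B0 : 0 <= B by exact: le_trans (G0 0) (GB 0).
pose D y := (\sum_(0 <= k <oo) (dyadic k y)%:E)%E.
have D0 y : (0 <= D y)%E by apply: nneseries_ge0 => k _ _; rewrite lee_fin.
have mD : measurable_fun setT D.
  apply: ge0_emeasurable_sum => [k y _ _|k _]; first by rewrite lee_fin.
  exact/measurable_EFinP.
have mGE : measurable_fun setT (fun y => (A * G y)%:E).
  by apply/measurable_EFinP; exact: measurable_funM.
have mDE : measurable_fun setT (fun y => ((A * B)%:E * D y)%E).
  by apply: emeasurable_funM => //; exact: measurable_cst.
have AB0 : 0 <= A * B by rewrite mulr_ge0.
apply: (@le_lt_trans _ _ (\int[mu]_(y in Om) ((A * G y)%:E + (A * B)%:E * D y))%E).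
  apply: ge0_le_integral => //.
  - by move=> y yO; rewrite lee_fin mulr_ge0 ?hkernel_ge0 ?invrho_ge0.
  - apply/measurable_EFinP; apply: measurable_funM.
      apply: measurable_funTS; apply: continuous_measurable_rV.
      exact: continuous_hkernel.
    by apply: measurable_funTS; exact: measurable_invrho.
  - by apply: emeasurable_funD; apply: measurable_funTS.
  move=> y yO; apply: (@le_trans _ _ (A * (G y * enorm y `^ (- gamma)))%:E).
    by rewrite lee_fin hkernel_invrho_le.
  have y0 := enorm_gt0 yO; have [y1|y1] := leP 1 (enorm y).
    apply: (@le_trans _ _ (A * G y)%:E); last by rewrite leeDl// mule_ge0// lee_fin.
    rewrite lee_fin ler_wpM2l// ler_piMr// powRN invf_le1 ?powR_gt0//.
    by rewrite -(powRr0 (enorm y)) ler_powR//; case/andP: gammaN => /ltW.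
  apply: (@le_trans _ _ ((A * B)%:E * (enorm y `^ (- gamma))%:E)%E).
    by rewrite -EFinM lee_fin mulrA ler_wpM2r ?powR_ge0// ler_wpM2l.
  apply: (@le_trans _ _ ((A * B)%:E * D y)%E).
    by rewrite lee_wpmul2l ?lee_fin// dyadic_le.
  by rewrite leeDr// lee_fin mulr_ge0.
apply: (@le_lt_trans _ _ (\int[mu]_y ((A * G y)%:E + (A * B)%:E * D y))%E).
  apply: ge0_subset_integral => //; first exact: emeasurable_funD.
  by move=> y _; rewrite adde_ge0 ?mule_ge0 ?lee_fin// mulr_ge0.
rewrite ge0_integralD//; last 2 first.
- by move=> y _; rewrite lee_fin mulr_ge0.
- by move=> y _; rewrite mule_ge0 ?lee_fin.
apply: lte_add_pinfty.
  under eq_integral do rewrite EFinM.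
  rewrite ge0_integralZl//; last 2 first.
    by apply/measurable_EFinP; exact: mG.
    by move=> y _; rewrite lee_fin.
  rewrite (integral_rV_prod mg) => [|i z]; last by rewrite ltW// gaussian_gt0.
  rewrite big1 ?mule1 ?ltry// => i _.
  under eq_integral do rewrite gaussian_shift//.
  exact: integral_normal_pdf.
rewrite ge0_integralZl//.
by rewrite lte_mul_pinfty ?lee_fin// ?fin_numE.
Qed.

End weight.

(** * Comparison from a positive time *)

Section start_at_positive_time.
Context {R : realType} {N : nat}.
Variables (m : nat) (gamma alpha C : R) (u0 : 'rV[R]_N -> R).
Variable u : R -> 'rV[R]_N -> R.
Hypothesis solu : is_solution m gamma alpha C u0 u.
Hypothesis alpha0 : 0 < alpha.
Local Notation mu := (lebesgue_rV R N).
Local Notation Om := (@Omega R N m).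
Local Notation uext := (uext m u).
Implicit Types (s t : R) (x y : 'rV[R]_N) (i : 'I_N).

(** The value of the heat flow on the positive part of the solution at time [s].
It takes values in the extended reals, since no bound on the solution is used
until the limit s -> 0. *)
Definition positive_part_flow s t x : \bar R :=
  (\int[mu]_(y in Om) (hkernel m t x y * Num.max (uext s y) 0)%:E)%E.

(* Subtracting e makes the support compact, as the solution is small near the
   boundary and at infinity. *)
Let cutoff s e y := Num.max (uext s y - e) 0.

Let cutoff_continuous s e : 0 < s -> continuous (cutoff s e).
Proof.
move=> s0 y.
have cs : {for y, continuous (fun y => uext s y - e)}.
  exact: (continuousB (@uext_continuous_space _ _ _ _ _ _ _ _ solu s s0 y) (@cst_continuous _ _ e y)).
exact: (continuous_max cs (@cst_continuous _ _ 0 y)).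
Qed.

Let cutoff_out s e y : 0 < e -> ~ Om y -> cutoff s e y = 0.
Proof. by move=> e0 yO; rewrite /cutoff uext_out// max_r// sub0r oppr_le0 ltW. Qed.

Let cutoff_ge0 s e y : 0 <= cutoff s e y.
Proof. by rewrite /cutoff le_max lexx orbT. Qed.

Let cutoff_support s e : 0 < s -> 0 < e ->
  exists2 M, 0 <= M & forall y, ~ cube M y -> cutoff s e y = 0.
Proof.
move=> s0 e0; have [M hM] := sol_decay_uniform solu s s0 e0.
exists (Num.max M 0); first by rewrite le_max lexx orbT.
move=> y /enorm_notin_cube yM; have [yO|] := pselect (Om y); last exact: cutoff_out.
rewrite /cutoff uextE// max_r// subr_le0 (le_trans (ler_norm _))// ltW//.
apply: hM => //; first by rewrite lexx.
by apply: le_lt_trans yM; rewrite le_max lexx.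
Qed.

(** For small h > 0 the comparison runs from s + h to s + t, with the potential of
the cutoff started at time s, and gives absorb (t - h) as a bound; then h -> 0. *)
Lemma sol_le_absorb s t x v : 0 < s -> 0 < t -> Om x ->
  (positive_part_flow s t x < v%:E)%E -> u (s + t) x <= absorb alpha t v.
Proof.
move=> s0 t0 xO Wv.
have W0 : (0 <= positive_part_flow s t x)%E.
  apply: integral_ge0 => y yO; rewrite lee_fin mulr_ge0 ?hkernel_ge0//.
  by rewrite le_max lexx orbT.
have Wfin : positive_part_flow s t x \is a fin_num.
  by rewrite ge0_fin_numE// (lt_trans Wv)// ltry.
pose w := fine (positive_part_flow s t x).
have WE : positive_part_flow s t x = w%:E by rewrite fineK.
have w0 : 0 <= w by rewrite fine_ge0.
have wv : w < v by rewrite -lte_fin -WE.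
(* so that w + 3 e = v *)
pose e := (v - w) / 3.
have e0 : 0 < e by rewrite divr_gt0// subr_gt0.
have v0 : 0 < v by exact: le_lt_trans wv.
have [M M0 supp] := cutoff_support s0 e0.
pose phi := cutoff s e.
have cphi : continuous phi by exact: cutoff_continuous.
have phi0 y : 0 <= phi y by exact: cutoff_ge0.
have phiO y : ~ Om y -> phi y = 0 by exact: cutoff_out.
have [t1 t10 appr] := approximate_identity M0 cphi supp phi0 phiO e0.
have potW : potential m phi t x <= w.
  rewrite -lee_fin (EFin_potential m M0 cphi supp)// -WE.
  rewrite [leRHS]integral_mkcond; apply: ge0_le_integral => //.
  - by move=> y _; rewrite lee_fin hkernel_phi_ge0.
  - apply/measurable_EFinP; apply: measurable_funM;
      apply: continuous_measurable_rV => //; exact: continuous_hkernel.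
  - apply/(measurable_restrictT _ _).1; first exact: measurable_Omega.
    apply/measurable_EFinP; apply: measurable_funTS; apply: measurable_funM;
      apply: continuous_measurable_rV; first exact: continuous_hkernel.
    move=> y; exact: (continuous_max (@uext_continuous_space _ _ _ _ _ _ _ _ solu s s0 y)
      (@cst_continuous _ _ 0 y)).
  move=> y _; rewrite patchE; case: ifPn => [|/negP]; rewrite inE => yO.
    rewrite lee_fin ler_wpM2l ?hkernel_ge0// /phi /cutoff.
    by rewrite ge_max !le_max lerBlDr lerDl (ltW e0) lexx orbT.
  by rewrite phiO// mulr0.
(* Of the margin 3 e, one e pays for the cutoff, one for the approximate identity,
   and one for the change of u between the times s and s + h. *)
have step : \forall h \near 0^'+, u (s + t) x <= absorb alpha (t - h) v.
  have near_s : \forall h \near 0^'+, forall y, Om y -> `|u s y - u (s + h) y| < e.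
    have /nbhs_ballP[d /= d0 hd] := sol_near_uniform solu s0 e0.
    near=> h.
    have h0 : 0 < h by near: h; exact: nbhs_right_gt.
    have hd' : h < d by near: h; exact: nbhs_right_lt.
    move=> y yO; apply: hd; last exact: subset_closure.
    by rewrite /ball/= opprD addNKr normrN gtr0_norm.
  near=> h.
  have h0 : 0 < h by near: h; exact: nbhs_right_gt.
  have ht : h <= t by near: h; exact: nbhs_right_le.
  have ht1 : h < t1 by near: h; exact: nbhs_right_lt.
  have hs : forall y, Om y -> `|u s y - u (s + h) y| < e by near: h; exact: near_s.
  pose V t x := potential m phi (t - s) x + 3 * e.
  have sub_gt0 t' : s + h <= t' -> 0 < t' - s by rewrite subr_gt0; lra.
  have cmp : u (s + t) x <= absorb alpha (s + t - (s + h)) (V (s + t) x).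
    apply: (@comparison R N m gamma alpha C u0 u solu alpha0 V
      (fun i t => dpotential m phi i 1 (t - s)) (fun i t => dpotential m phi i 2 (t - s))
      (s + h) (s + t) (3 * e)) => //.
    - by rewrite addr_gt0.
    - by rewrite lerD2l.
    - by rewrite mulr_gt0.
    - move=> t' y /andP[t'h _]; apply: cvgD; last exact: cvg_cst.
      apply: (@continuous2_cvg _ _ _ _ _ (nbhs_filter (t', y)) (fun p => p.1 - s)
        snd (potential m phi) (t' - s) y).
      + by apply: (potential_continuous M0 cphi supp); exact: sub_gt0.
      + by apply: cvgB; [exact: cvg_fst|exact: cvg_cst].
      + exact: cvg_snd.
    - move=> t' y /andP[t'h _] yO; rewrite lerDr.
      exact: (potential_ge0 phi0 phiO (sub_gt0 _ t'h) yO).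
    - move=> i t' y r /andP[/ltW/sub_gt0 t'h _].
      rewrite /V; under eq_fun do rewrite (potential_dpotential m phi i).
      have H := @is_derive_dpotential R N m M phi M0 cphi supp i 0 _ y r isT t'h.
      apply: (is_derive_eq (is_derive_addf H (is_derive_cst (3 * e) r 1))).
      by rewrite addr0.
    - move=> i t' y r /andP[/ltW/sub_gt0 t'h _].
      exact: (@is_derive_dpotential R N m M phi M0 cphi supp i 1 _ y r isT t'h).
    - move=> t' y /andP[/ltW/sub_gt0 t'h _].
      have hsub : is_derive t' 1 (fun t => t - s) 1.
        apply: (is_derive_eq (is_derive_addf (is_derive_id t' 1) (is_derive_cst (- s) t' 1))).
        by rewrite addr0.
      have H := @is_derive_compf R (potential m phi ^~ y) (fun t => t - s) t' _ _
        (is_derive_potential_time m M0 cphi supp y t'h) hsub.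
      apply: (is_derive_eq (is_derive_addf H (is_derive_cst (3 * e) t' 1))).
      by rewrite mulr1 addr0.
    - move=> y yO; rewrite /V addrAC subrr add0r.
      have h0t1 : 0 < h < t1 by rewrite h0.
      have := appr h y h0t1 yO; have := hs y yO.
      have : u s y - e <= phi y by rewrite /phi /cutoff uextE// le_max lexx.
      by rewrite ltr_norml => ? /andP[? ?]; lra.
  apply: le_trans cmp _; rewrite opprD addrACA subrr add0r.
  have Vt : V (s + t) x = potential m phi t x + 3 * e by rewrite /V addrAC subrr add0r.
  rewrite Vt; apply: absorb_le => //; first by rewrite subr_ge0.
    by apply: ltr_wpDl; [exact: (potential_ge0 phi0 phiO)|rewrite mulr_gt0].
  apply: (@le_trans _ _ (w + 3 * e)); first by rewrite lerD2r.
  by rewrite /e; lra.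
rewrite leNgt; apply/negP => ult.
have lim : absorb alpha (t - h) v @[h --> 0^'+] --> absorb alpha t v.
  apply: cvg_absorb => //; first exact: ltW.
    rewrite -[X in _ --> X]subr0; apply: cvgB; first exact: cvg_cst.
    exact: cvg_within_filter cvg_id.
  exact: cvg_cst.
have h2 : \forall h \near 0^'+, absorb alpha (t - h) v < u (s + t) x.
  exact: (cvgr_lt _ lim _ ult).
near ((0 : R)^'+) => h.
have : absorb alpha (t - h) v < u (s + t) x by near: h.
by rewrite ltNge => /negP; apply; near: h.
Unshelve. all: by end_near. Qed.

End start_at_positive_time.

(** * The limit of vanishing initial time *)

Section small_time_limit.
Context {R : realType} {N : nat}.
Variables (m : nat) (gamma : R).
Hypothesis mN : (1 <= m <= N)%N.
Hypothesis gammaN : 0 < gamma < N%:R.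
Local Notation mu := (lebesgue_rV R N).
Local Notation Om := (@Omega R N m).
Implicit Types (s t : R) (x y : 'rV[R]_N) (i : 'I_N) (n : nat).

Lemma hkernel_le t x y : 0 < t -> Om x -> Om y ->
  hkernel m t x y <= gaussian t 0 ^+ N.
Proof.
move=> t0 xO yO; have -> : gaussian t 0 ^+ N = \prod_(i < N) gaussian t 0.
  by rewrite prodr_const card_ord.
apply: ler_prod => i _; apply/andP; split.
  by apply: kernel1_ge0 => // im; rewrite ltW//; [exact: xO|exact: yO].
rewrite /kernel1 /dgaussian/= !mul1r lerBlDr.
apply: (@le_trans _ _ (gaussian t 0)); last first.
  by rewrite lerDl mulr_ge0// ltW// gaussian_gt0.
rewrite /gaussian ler_expR lerD2l lerN2 expr0n mul0r divr_ge0 ?sqr_ge0//.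
by rewrite mulr_ge0// ltW.
Qed.

(** An essential supremum bound is a pointwise bound almost everywhere, to be
divided by rho > 0. *)
Lemma Xnorm_ae (psi : 'rV[R]_N -> R) K : (Xnorm m gamma psi <= K%:E)%E ->
  {ae mu, forall y, Om y -> `|psi y| <= K * invrho m gamma y}.
Proof.
rewrite /Xnorm unlock; case: ltP => [_|mu0 _]; last first.
  exists setT; split => //; apply/eqP; rewrite eq_le mu0/=.
  exact: measure_ge0.
move=> /ess_supP; apply: filterS => y /= + yO.
rewrite patchE mem_set// lee_fin normrM => h.
have r1 := rho_invrho gamma mN yO; have i0 := invrho_ge0 gamma yO.
have := ler_wpM2r i0 h; apply: le_trans.
have r0 : 0 <= rho m gamma y.
  by rewrite /rho divr_ge0 ?powR_ge0// ltW// prod_coord_gt0.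
by rewrite (ger0_norm r0) mulrAC r1 mul1r.
Qed.

Definition exhaustion n : set 'rV[R]_N := [set y | forall i,
  `[if (i < m)%N then n.+1%:R^-1 else - n%:R, n%:R]%classic (y ord0 i)].

Lemma compact_exhaustion n : compact (exhaustion n).
Proof.
apply: (@rV_compact R N (fun i : 'I_N =>
  `[if (i < m)%N then n.+1%:R^-1 else - n%:R, n%:R]%classic)) => i.
exact: segment_compact.
Qed.

Lemma measurable_exhaustion n : measurable (exhaustion n).
Proof.
rewrite (_ : exhaustion n = \bigcap_(i in [set: 'I_N]) [set y : 'rV[R]_N |
    `[if (i < m)%N then n.+1%:R^-1 else - n%:R, n%:R]%classic (y ord0 i)]).
  apply: fin_bigcap_measurable => // i _; rewrite -[X in measurable X]setTI.
  by apply: (measurable_coord i measurableT); exact: measurable_itv.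
by apply/seteqP; split => x /= h i => [_|]; exact: h.
Qed.

Lemma exhaustion_sub n : exhaustion n `<=` Om.
Proof.
move=> y yn i im; have := yn i; rewrite im /= in_itv/= => /andP[+ _].
by apply: lt_le_trans; rewrite invr_gt0.
Qed.

Lemma exhaustion_nondecreasing : nondecreasing_seq exhaustion.
Proof.
move=> n1 n2 n12; apply/subsetPset => y yn i; have := yn i.
rewrite /= !in_itv/= => /andP[y1 y2]; have h : n1%:R <= n2%:R :> R by rewrite ler_nat.
rewrite (le_trans y2)// andbT (le_trans _ y1)//; case: ifP => _.
  by rewrite lef_pV2 ?posrE// ler_nat.
by rewrite lerN2.
Qed.

Lemma bigcup_exhaustion : \bigcup_n exhaustion n = Om.
Proof.
apply/seteqP; split=> [y [n _]|y yO]; first exact: exhaustion_sub.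
have [n _ /(_ n (leqnn n)) yn] : \forall n \near \oo, exhaustion n y.
  apply: filter_forall => i.
  have h1 : \forall n \near \oo, `|y ord0 i| <= n%:R.
    exact: nbhs_infty_ger.
  have h2 : \forall n \near \oo, (i < m)%N -> n.+1%:R^-1 <= y ord0 i.
    have [im|im] := boolP (i < m)%N; last exact: nearW.
    by apply: filterS (near_infty_natSinv_lt (PosNum (yO i im))) => n /ltW.
  apply: filterS2 h1 h2 => n; rewrite ler_norml => /andP[y1 y2] h.
  by rewrite /= in_itv/= y2 andbT; case: ifP => // /h.
by exists n.
Qed.

Variables (t : R) (x : 'rV[R]_N).
Hypotheses (t0 : 0 < t) (xO : Om x).
Local Notation h := (hkernel m t x).
Local Notation w := (invrho m gamma).

Let mh : measurable_fun Om h.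
Proof.
apply: measurable_funTS; apply: continuous_measurable_rV.
exact: continuous_hkernel.
Qed.

Let mOm : measurable Om. Proof. exact: measurable_Omega. Qed.

Let h0 y : Om y -> 0 <= h y. Proof. by move=> yO; exact: hkernel_ge0. Qed.

(** The integrals over the exhaustion increase to the finite integral over Omega. *)
Lemma weighted_tail_small e : 0 < e ->
  exists n, (\int[mu]_(y in Om `\` exhaustion n) (h y * w y)%:E <= e%:E)%E.
Proof.
move=> e0; pose f y := (h y * w y)%:E.
have f0 y : Om y -> (0 <= f y)%E.
  by move=> yO; rewrite lee_fin mulr_ge0 ?h0// invrho_ge0.
have mf : measurable_fun Om f.
  apply/measurable_EFinP; apply: measurable_funM => //.
  by apply: measurable_funTS; exact: measurable_invrho.
have Ilty := hkernel_invrho_integrable mN gammaN t0 xO.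
have I0 : (0 <= \int[mu]_(y in Om) f y)%E by exact: integral_ge0.
have Ifin : (\int[mu]_(y in Om) f y)%E \is a fin_num by rewrite ge0_fin_numE.
have := @ge0_nondecreasing_set_cvg_integral _ _ R exhaustion f mu
  exhaustion_nondecreasing measurable_exhaustion
  (fun n => measurable_funS mOm (@exhaustion_sub n) mf)
  (fun n y yn => f0 y (exhaustion_sub yn)).
rewrite bigcup_exhaustion => cv.
pose r := fine (\int[mu]_(y in Om) f y)%E.
have rE : (\int[mu]_(y in Om) f y)%E = r%:E by rewrite fineK.
have op : open [set z : \bar R | ((r - e)%:E < z)%E] by exact: open_ereal_gt_ereal.
have [|n _ /(_ n (leqnn n)) /= hn] := cv [set z : \bar R | ((r - e)%:E < z)%E].
  by apply: open_nbhs_nbhs; split => //=; rewrite rE lte_fin ltrBlDr ltrDl.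
exists n.
have U : exhaustion n `|` (Om `\` exhaustion n) = Om.
  by rewrite setDUK//; exact: exhaustion_sub.
have mD : measurable (Om `\` exhaustion n).
  by apply: measurableD => //; exact: measurable_exhaustion.
have S : (\int[mu]_(y in exhaustion n) f y +
    \int[mu]_(y in Om `\` exhaustion n) f y = r%:E)%E.
  rewrite -rE -[in RHS]U ge0_integral_setU ?U//.
  - exact: measurable_exhaustion.
  - by rewrite disj_set2E setDIK.
have a0 : (0 <= \int[mu]_(y in Om `\` exhaustion n) f y)%E.
  by apply: integral_ge0 => y [yO _]; exact: f0.
move: S hn a0; move: (\int[mu]_(y in exhaustion n) f y)%E => a.
change (fun y => (h y * w y)%:E) with f.
move: (\int[mu]_(y in Om `\` exhaustion n) f y)%E => b.
move: a b => [a| |] [b| |] //=; rewrite -EFinD => -[<-].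
by rewrite !lte_fin !lee_fin; lra.
Qed.

Variables (alpha C : R) (u0 : 'rV[R]_N -> R) (u : R -> 'rV[R]_N -> R).
Hypothesis solu : is_solution m gamma alpha C u0 u.
Hypothesis Xu0 : Xspace m gamma u0.

Let mu0 : measurable_fun Om u0. Proof. by case: Xu0. Qed.

(* One constant for u0 and for all times, which is where the bound of the
   solution map in the weighted space is used. *)
Let Xbound : exists2 K, 0 <= K &
  {ae mu, forall y, Om y -> `|u0 y| <= K * w y} /\
  forall s, 0 < s -> {ae mu, forall y, Om y -> `|u s y| <= K * w y}.
Proof.
have [_ Xlt] := Xu0.
have X0 : (0 <= Xnorm m gamma u0)%E by exact: Lnorm_ge0.
have Xfin : Xnorm m gamma u0 \is a fin_num by rewrite ge0_fin_numE.
pose X := fine (Xnorm m gamma u0).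
have XE : Xnorm m gamma u0 = X%:E by rewrite fineK.
pose K := Num.max `|X| `|C * X|; exists K; first by rewrite le_max normr_ge0.
split=> [|s s0]; apply: Xnorm_ae.
  by rewrite XE lee_fin le_max ler_norm.
apply: le_trans (sol_bound solu s0) _.
by rewrite XE -EFinM lee_fin le_max (ler_norm (C * X)) orbT.
Qed.

Let mus s : 0 < s -> measurable_fun setT (uext m u s).
Proof. by move=> s0; apply: continuous_measurable_rV; exact: (uext_continuous_space solu s0). Qed.

Let mdiff s : 0 < s ->
  measurable_fun Om (fun y => (h y * `|uext m u s y - u0 y|)%:E).
Proof.
move=> s0; apply/measurable_EFinP; apply: measurable_funM => //.
apply: measurableT_comp; first exact: normr_measurable.
by apply: measurable_funB => //; apply: measurable_funTS; exact: mus.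
Qed.

(** On a compact part of the exhaustion the kernel is bounded and the initial value
is attained in L^1; off it, the weighted bounds make the integral small uniformly
in [s]. *)
Lemma weighted_initial_trace e : 0 < e -> \forall s \near 0^'+,
  (\int[mu]_(y in Om) (h y * `|uext m u s y - u0 y|)%:E < e%:E)%E.
Proof.
move=> e0; have [K K0 [bu0 bus]] := Xbound.
pose B := gaussian t 0 ^+ N.
have B0 : 0 <= B by rewrite exprn_ge0// ltW// gaussian_gt0.
pose d := e / 4 / (K + 1); have d0 : 0 < d by rewrite !divr_gt0// ltr_wpDl.
have [n hn] := weighted_tail_small d0.
have An : (\int[mu]_(y in exhaustion n) `|u s y - u0 y|%:E)%E @[s --> 0^'+] --> 0%E.
  exact: (sol_initial solu (@compact_exhaustion n) (@exhaustion_sub n)).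
have e4 : 0 < e / 4 / (B + 1) by rewrite !divr_gt0// ltr_wpDl.
have op : open [set z : \bar R | (z < (e / 4 / (B + 1))%:E)%E] by exact: open_ereal_lt_ereal.
have {op}An : \forall s \near 0^'+,
    (\int[mu]_(y in exhaustion n) `|u s y - u0 y|%:E < (e / 4 / (B + 1))%:E)%E.
  apply: (An [set z : \bar R | (z < (e / 4 / (B + 1))%:E)%E]).
  by apply: open_nbhs_nbhs; split.
near=> s.
have s0 : 0 < s by near: s; exact: nbhs_right_gt.
have U : exhaustion n `|` (Om `\` exhaustion n) = Om.
  by rewrite setDUK//; exact: exhaustion_sub.
have mE := measurable_exhaustion n.
have mD : measurable (Om `\` exhaustion n) by exact: measurableD.
have DO : Om `\` exhaustion n `<=` Om by move=> y [].
have -> : (\int[mu]_(y in Om) (h y * `|uext m u s y - u0 y|)%:E =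
    \int[mu]_(y in exhaustion n) (h y * `|uext m u s y - u0 y|)%:E +
    \int[mu]_(y in Om `\` exhaustion n) (h y * `|uext m u s y - u0 y|)%:E)%E.
  rewrite -[in LHS]U ge0_integral_setU ?U//.
  - exact: mdiff.
  - by move=> y yO; rewrite lee_fin mulr_ge0 ?h0.
  - by rewrite disj_set2E setDIK.
have mabs : measurable_fun (exhaustion n) (fun y => `|u s y - u0 y|%:E).
  apply: (eq_measurable_fun (fun y => `|uext m u s y - u0 y|%:E)).
    by move=> y /[!inE] yn; rewrite uextE//; exact: exhaustion_sub.
  apply/measurable_EFinP; apply: measurableT_comp; first exact: normr_measurable.
  apply: measurable_funB; first by apply: measurable_funTS; exact: mus.
  by apply: measurable_funS mu0 => //; exact: exhaustion_sub.
have I1 : (\int[mu]_(y in exhaustion n) (h y * `|uext m u s y - u0 y|)%:E <= (e / 4)%:E)%E.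
  apply: (@le_trans _ _ (\int[mu]_(y in exhaustion n) (B%:E * `|u s y - u0 y|%:E))%E).
    apply: ge0_le_integral => //.
    - by move=> y /exhaustion_sub yO; rewrite lee_fin mulr_ge0 ?h0.
    - by apply: measurable_funS (mdiff s0) => //; exact: exhaustion_sub.
    - by apply: emeasurable_funM => //; exact: measurable_cst.
    move=> y /exhaustion_sub yO; rewrite -EFinM lee_fin uextE// ler_wpM2r//.
    exact: hkernel_le.
  rewrite ge0_integralZl//.
  apply: (@le_trans _ _ (B%:E * (e / 4 / (B + 1))%:E)%E).
    by rewrite lee_wpmul2l ?lee_fin// ltW//; near: s.
  rewrite -EFinM lee_fin mulrCA ler_piMr ?divr_ge0 ?(ltW e0)//.
  by rewrite ler_pdivrMr ?mul1r ?lerDl// ltr_wpDl.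
have I2 : (\int[mu]_(y in Om `\` exhaustion n) (h y * `|uext m u s y - u0 y|)%:E <= (e / 2)%:E)%E.
  have mw : measurable_fun (Om `\` exhaustion n) (fun y => (h y * w y)%:E).
    apply/measurable_EFinP; apply: measurable_funM; first exact: measurable_funS mh.
    by apply: measurable_funTS; exact: measurable_invrho.
  have hw0 y : (Om `\` exhaustion n) y -> (0 <= (h y * w y)%:E)%E.
    by move=> [yO _]; rewrite lee_fin mulr_ge0 ?h0// invrho_ge0.
  apply: (@le_trans _ _ (\int[mu]_(y in Om `\` exhaustion n) ((2 * K)%:E * (h y * w y)%:E))%E).
    apply: ae_ge0_le_integral => //.
    - by move=> y [yO _]; rewrite lee_fin mulr_ge0 ?h0.
    - exact: measurable_funS (mdiff s0).
    - by move=> y yD; rewrite mule_ge0 ?hw0// lee_fin mulr_ge0.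
    - by apply: emeasurable_funM => //; exact: measurable_cst.
    apply: filterS2 bu0 (bus s s0) => y b1 b2 [yO _].
    rewrite -EFinM lee_fin uextE// mulrCA ler_wpM2l ?h0//.
    by rewrite (le_trans (ler_normB _ _))//; have := b1 yO; have := b2 yO; lra.
  rewrite ge0_integralZl//; last by rewrite lee_fin mulr_ge0.
  apply: (@le_trans _ _ ((2 * K)%:E * d%:E)%E).
    by rewrite lee_wpmul2l// lee_fin mulr_ge0.
  rewrite -EFinM lee_fin /d mulrA ler_pdivrMr ?ltr_wpDl//.
  by nra.
apply: (@le_lt_trans _ _ ((e / 4)%:E + (e / 2)%:E)%E); first exact: leeD.
by rewrite -EFinD lte_fin; lra.
Unshelve. all: by end_near. Qed.

Hypothesis u0_ge0 : {ae mu, forall y, Om y -> 0 <= u0 y}.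

(** The real-valued integral defining the semigroup is the true one, because the
weighted bound makes the integrand integrable. *)
Lemma EFin_heat_semigroup : (heat_semigroup m t u0 x)%:E =
  (\int[mu]_(y in Om) (h y * `|u0 y|)%:E)%E.
Proof.
have [K K0 [bu0 _]] := Xbound.
have mhu : measurable_fun Om (fun y => (h y * u0 y)%:E).
  by apply/measurable_EFinP; exact: measurable_funM.
have mhau : measurable_fun Om (fun y => (h y * `|u0 y|)%:E).
  apply/measurable_EFinP; apply: measurable_funM => //.
  by apply: measurableT_comp => //; exact: normr_measurable.
have E : (\int[mu]_(y in Om) (heat_kernel m t x y * u0 y)%:E =
    \int[mu]_(y in Om) (h y * `|u0 y|)%:E)%E.
  under eq_integral do rewrite heat_kernelE//.
  apply: ae_eq_integral => //; apply: filterS u0_ge0 => y uy yO.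
  by rewrite ger0_norm// uy.
rewrite /heat_semigroup /Rintegral E fineK// ge0_fin_numE; last first.
  by apply: integral_ge0 => y yO; rewrite lee_fin mulr_ge0 ?h0.
apply: (@le_lt_trans _ _ (\int[mu]_(y in Om) (K%:E * (h y * w y)%:E))%E).
  have hw0 y : Om y -> (0 <= (h y * w y)%:E)%E.
    by move=> yO; rewrite lee_fin mulr_ge0 ?h0// invrho_ge0.
  apply: ae_ge0_le_integral => //.
  - by move=> y yO; rewrite lee_fin mulr_ge0 ?h0.
  - by move=> y yO; rewrite mule_ge0 ?hw0.
  - apply: emeasurable_funM; first exact: measurable_cst.
    apply/measurable_EFinP; apply: measurable_funM => //.
    by apply: measurable_funTS; exact: measurable_invrho.
  apply: filterS bu0 => y b1 yO.
  by rewrite -EFinM lee_fin mulrCA ler_wpM2l ?h0// b1.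
rewrite ge0_integralZl//; last 2 first.
- apply/measurable_EFinP; apply: measurable_funM => //.
  by apply: measurable_funTS; exact: measurable_invrho.
- by move=> y yO; rewrite lee_fin mulr_ge0 ?h0// invrho_ge0.
apply: lte_mul_pinfty; rewrite ?lee_fin//.
exact: (hkernel_invrho_integrable mN gammaN t0 xO).
Qed.

(** u(s)^+ <= |u0| + |u(s) - u0|. *)
Lemma positive_part_flow_near v : heat_semigroup m t u0 x < v ->
  \forall s \near 0^'+, (positive_part_flow m u s t x < v%:E)%E.
Proof.
move=> uv; have e0 : 0 < v - heat_semigroup m t u0 x by rewrite subr_gt0.
near=> s.
have s0 : 0 < s by near: s; exact: nbhs_right_gt.
have mhau : measurable_fun Om (fun y => (h y * `|u0 y|)%:E).
  apply/measurable_EFinP; apply: measurable_funM => //.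
  by apply: measurableT_comp => //; exact: normr_measurable.
apply: (@le_lt_trans _ _ (\int[mu]_(y in Om) ((h y * `|u0 y|)%:E +
    (h y * `|uext m u s y - u0 y|)%:E))%E).
  apply: ge0_le_integral => //.
  - by move=> y yO; rewrite lee_fin mulr_ge0 ?h0// le_max lexx orbT.
  - apply/measurable_EFinP; apply: measurable_funM => //.
    apply: measurable_funTS; apply: continuous_measurable_rV => y.
    exact: (continuous_max (@uext_continuous_space _ _ _ _ _ _ _ _ solu s s0 y)
      (@cst_continuous _ _ 0 y)).
  - by apply: emeasurable_funD => //; exact: mdiff.
  move=> y yO; rewrite -EFinD lee_fin -mulrDr ler_wpM2l ?h0//.
  rewrite ge_max addr_ge0// andbT -[leLHS](subrK (u0 y)) addrC.
  by rewrite lerD// ler_norm.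
rewrite ge0_integralD//; last 3 first.
- by move=> y yO; rewrite lee_fin mulr_ge0 ?h0.
- by move=> y yO; rewrite lee_fin mulr_ge0 ?h0.
- exact: mdiff.
rewrite -EFin_heat_semigroup -[v in ltRHS](subrKC (heat_semigroup m t u0 x)).
rewrite EFinD lteD2lE//.
by near: s; exact: weighted_initial_trace.
Unshelve. all: by end_near. Qed.

End small_time_limit.

(** * The upper bound *)

(** For the points where the heat flow of the initial value vanishes, at which the
continuity of [absorb] in a positive argument says nothing. *)
Lemma absorb_le_self (R : realType) (alpha s v : R) :
  0 < alpha -> 0 <= s -> 0 < v -> absorb alpha s v <= v.
Proof.
move=> a0 s0 v0; rewrite absorbE// ler_piMr ?(ltW v0)//.
have h1 : 1 <= 1 + alpha * s * v `^ alpha.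
  by rewrite lerDl !mulr_ge0 ?powR_ge0// ltW.
rewrite invf_le1; last by rewrite powR_gt0// (lt_le_trans ltr01).
rewrite -[leLHS](powRr0 (1 + alpha * s * v `^ alpha)).
by rewrite ler_powR// invr_ge0 ltW.
Qed.

Theorem proposition1p5 (R : realType) (N m : nat) (gamma alpha C : R)
    (u0 : 'rV[R]_N -> R) (u : R -> 'rV[R]_N -> R) :
  (1 <= N)%N -> (1 <= m <= N)%N ->
  0 < gamma < N%:R -> 0 < alpha ->
  Xspace m gamma u0 ->
  {ae lebesgue_rV R N, forall x, Omega m x -> 0 <= u0 x} ->
  is_solution m gamma alpha C u0 u ->
  forall (t : R) (x : 'rV[R]_N), 0 < t -> Omega m x ->
    u t x <= heat_semigroup m t u0 x /
      (1 + alpha * t * heat_semigroup m t u0 x `^ alpha) `^ alpha^-1.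
Proof.
move=> _ mN gammaN alpha0 Xu0 u0_ge0 solu t x t0 xO.
set v := heat_semigroup m t u0 x.
have v0 : 0 <= v.
  rewrite -lee_fin (EFin_heat_semigroup mN gammaN t0 xO solu Xu0 u0_ge0).
  by apply: integral_ge0 => y yO; rewrite lee_fin mulr_ge0 ?hkernel_ge0.
(* Comparison from the time s up to s + t, then s -> 0. *)
have below v1 : v < v1 -> u t x <= absorb alpha t v1.
  move=> vv1; rewrite leNgt; apply/negP => ult.
  have cu : uext m u (s + t) x @[s --> 0^'+] --> uext m u t x.
    apply: (@continuous2_cvg _ _ _ _ _ _ (fun s => s + t) (cst x) (uext m u) t x).
    - exact: (uext_continuous solu).
    - rewrite -[X in _ --> X]add0r; apply: cvgD; last exact: cvg_cst.
      exact: cvg_within_filter cvg_id.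
    - exact: cvg_cst.
  rewrite uextE// in cu.
  near ((0 : R)^'+) => s.
  have s0 : 0 < s by near: s; exact: nbhs_right_gt.
  have : absorb alpha t v1 < uext m u (s + t) x.
    by near: s; exact: (cvgr_gt _ cu _ ult).
  rewrite uextE// ltNge => /negP; apply.
  apply: (sol_le_absorb solu alpha0 s0 t0 xO).
  by near: s; exact: (positive_part_flow_near mN gammaN t0 xO solu Xu0 u0_ge0).
have [v_gt0|v_le0] := ltP 0 v.
  rewrite -absorbE//; last exact: ltW.
  have lim : absorb alpha t v1 @[v1 --> v^'+] --> absorb alpha t v.
    apply: cvg_absorb => //; first exact: ltW.
      exact: cvg_cst.
    exact: cvg_within_filter cvg_id.
  rewrite leNgt; apply/negP => ult.
  near (v^'+) => v1.
  have : absorb alpha t v1 < u t x by near: v1; exact: (cvgr_lt _ lim _ ult).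
  by rewrite ltNge => /negP; apply; apply: below; near: v1; exact: nbhs_right_gt.
have -> : v = 0 by apply/eqP; rewrite eq_le v_le0.
rewrite mul0r; apply/ler_addgt0Pl => e e0; rewrite addr0.
apply: le_trans (below e _) (absorb_le_self alpha0 (ltW t0) e0).
exact: le_lt_trans e0.
Unshelve. all: by end_near. Qed.
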